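(* Let $T$ be a complete theory with monster model $\mathcal{U}$ and let $\varphi(x,y)$ be an $\mathcal{L}$-formula. The following are equivalent: (i) $\varphi(x,y)$ is NIP; (ii) for every small $M\models T$ (with $M\prec\mathcal{U}$), every $\mu\in\mathfrak{M}_\varphi(M)$ has a smooth global extension; (iii) for every small $M\models T$ with $|M|\le|T|$, every $\mu\in\mathfrak{M}_\varphi(M)$ has a strongly $\varphi_\triangle$-definable global extension; (iv) $\#(\mu,\varphi,\epsilon)<\infty$ for all $\mu\in\mathfrak{M}_\varphi(\mathcal{U})$ and $\epsilon>0$.
   Context: $\varphi(x,y)$ is NIP if there is no infinite set $B\subseteq\mathcal{U}^y$ such that for all disjoint finite $X,Y\subseteq B$ some $a$ satisfies $\varphi(a,b)$ for $b\in X$ and $\neg\varphi(a,b)$ for $b\in Y$ (equivalently, the family of instances of $\varphi$ has finite VC-dimension). A $\varphi$-formula over $A$ is a finite Boolean combination of instances $\varphi(x,b)$, $b\in A^y$; a $\varphi$-generated formula is a parameter-free Boolean combination of formulas $\varphi(x,y_i)$. $\mathfrak{M}_\varphi(A)$ is the set of finitely additive probability measures on $\varphi$-formulas over $A$; a global extension of $\mu\in\mathfrak{M}_\varphi(M)$ is $\nu\in\mathfrak{M}_\varphi(\mathcal{U})$ agreeing with $\mu$ on $\varphi$-formulas over $M$. $\nu\in\mathfrak{M}_\varphi(\mathcal{U})$ is smooth (over a small $A$) if it is the unique measure in $\mathfrak{M}_\varphi(\mathcal{U})$ extending $\nu|_A$. $\varphi_\triangle(x;y_1,y_2):=\varphi(x,y_1)\triangle\varphi(x,y_2)$.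 For a $\varphi$-generated $\theta(x,\bar y)$, $\operatorname{tp}_{\theta^*}(\bar b/A)$ is the set of Boolean combinations of formulas $\theta(a,\bar y)$, $a\in A^x$, true of $\bar b$, and $S_{\theta^*}(A)$ is the corresponding Stone space; $\nu$ is strongly $\theta$-definable over $A$ if $\nu(\theta(x,\bar b))$ depends only on $\operatorname{tp}_{\theta^*}(\bar b/A)$ and the induced map $S_{\theta^*}(A)\to[0,1]$ is continuous; ''strongly $\theta$-definable'' means over some small $A$. For $\mu\in\mathfrak{M}_\varphi(N)$, $\#(\mu,\varphi,\epsilon)$ is the supremum of $n$ such that there are $b_1,\dots,b_n\in N^y$ with $\mu(\varphi_\triangle(x;b_i,b_j))\ge\epsilon$ for all $i<j$. *)

(* Defs.v *)
From HB Require Import structures.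
From mathcomp Require Import all_boot all_order all_algebra.
From mathcomp Require Import all_classical all_reals all_analysis.

Set Implicit Arguments.
Unset Strict Implicit.
Unset Printing Implicit Defensive.

Import Order.TTheory GRing.Theory Num.Theory.
Import numFieldNormedType.Exports.

Local Open Scope classical_set_scope.
Local Open Scope card_scope.
Local Open Scope ring_scope.

Record language := Language {
  fun_sym : Type;
  rel_sym : Type;
  fun_ar : fun_sym -> nat;
  rel_ar : rel_sym -> nat }.

Inductive term (L : language) (n : nat) :=
| Var of 'I_n
| App (f : fun_sym L) of ('I_(fun_ar f) -> term L n).

(* [formula L n]: L-formulas with free variables v_0, ..., v_(n-1).  [FAll]
   binds v_0 of its argument and shifts the other variables by one. *)
Inductive formula (L : language) : nat -> Type :=
| FBot n : formula L n
| FEq n of term L n & term L n : formula L n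
| FRel n (r : rel_sym L) of ('I_(rel_ar r) -> term L n) : formula L n
| FImp n of formula L n & formula L n : formula L n
| FAll n of formula L n.+1 : formula L n.

Definition FNot (L : language) (n : nat) (psi : formula L n) : formula L n :=
  FImp psi (FBot L n).

Definition sentence (L : language) := formula L 0.

Record structure (L : language) := Structure {
  carrier :> Type;
  carrier_inhabited : inhabited carrier;
  interp_fun : forall f : fun_sym L, ('I_(fun_ar f) -> carrier) -> carrier;
  interp_rel : forall r : rel_sym L, ('I_(rel_ar r) -> carrier) -> Prop }.

Definition scons (T : Type) (n : nat) (d : T) (v : 'I_n -> T) : 'I_n.+1 -> T :=
  fun i => if unlift ord0 i is Some j then v j else d.

Definition fcat (T : Type) (m n : nat) (a : 'I_m -> T) (b : 'I_n -> T) :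
    'I_(m + n) -> T :=
  fun i => match fintype.split i with inl j => a j | inr k => b k end.

Fixpoint teval (L : language) (M : structure L) (n : nat) (v : 'I_n -> M)
    (t : term L n) : M :=
  match t with
  | Var i => v i
  | App f ts => interp_fun (fun i => teval v (ts i))
  end.

Fixpoint sat (L : language) (M : structure L) (n : nat) (psi : formula L n) :
    ('I_n -> M) -> Prop :=
  match psi in formula _ n return ('I_n -> M) -> Prop with
  | FBot _ => fun _ => False
  | FEq _ s t => fun v => teval v s = teval v t
  | FRel _ r ts => fun v => interp_rel (fun i => teval v (ts i))
  | FImp _ p q => fun v => sat p v -> sat q v
  | FAll _ p => fun v => forall d : M, sat p (scons d v)
  end.

Definition models (L : language) (M : structure L) (T : set (sentence L)) :=
  forall s, T s -> forall v : 'I_0 -> M, sat s v.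

Definition entails (L : language) (T : set (sentence L)) (s : sentence L) :=
  forall M : structure L, models M T -> models M [set s].

Definition complete_theory (L : language) (T : set (sentence L)) :=
  (exists M : structure L, models M T) /\
  (forall s : sentence L, entails T s \/ entails T (FNot s)).

Definition card_lt (S T : Type) (A : set S) (B : set T) :=
  A #<= B /\ ~ (B #<= A).

(* |T| is taken to be the number of L-formulas, that is |L| + aleph_0. *)
Definition all_formulas (L : language) := {n : nat & formula L n}.

(* A cardinal kappa is represented by a type K of that size. *)
Definition small (K S : Type) (A : set S) := card_lt A [set: K].

Definition tuples (S : Type) (A : set S) (n : nat) : set ('I_n -> S) :=
  [set v | forall i, A (v i)].
Arguments tuples [S] A n _.

Record is_substructure (L : language) (U : structure L) (M : set U) : Prop := {
  sub_nonempty : M !=set0;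
  sub_closed : forall (f : fun_sym L) v,
    tuples M (fun_ar f) v -> M (interp_fun v) }.

Lemma sub_inhabited (L : language) (U : structure L) (M : set U) :
  is_substructure M -> inhabited M.
Proof. by move=> [[x Mx] _]; constructor; exists x; exact/mem_set. Qed.

Lemma sub_fun_subproof (L : language) (U : structure L) (M : set U)
    (HM : is_substructure M) (f : fun_sym L) (v : 'I_(fun_ar f) -> M) :
  interp_fun (fun i => val (v i)) \in M.
Proof. by apply/mem_set/(sub_closed HM) => i; exact/set_mem/valP. Qed.

Definition substructure (L : language) (U : structure L) (M : set U)
    (HM : is_substructure M) : structure L :=
  @Structure L M (sub_inhabited HM)
    (fun f v => SigSub (sub_fun_subproof HM v))
    (fun r v => interp_rel (fun i => val (v i))).

Definition elementary_submodel (L : language) (T : set (sentence L))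
    (U : structure L) (M : set U) :=
  exists HM : is_substructure M,
    models (substructure HM) T /\
    forall (n : nat) (psi : formula L n) (v : 'I_n -> substructure HM),
      sat psi v <-> @sat L U n psi (fun i => val (v i)).

Definition param_formula (L : language) (U : structure L) (A : set U)
    (n : nat) := {k : nat & (formula L (n + k) * ('I_k -> A))%type}.

Definition psat (L : language) (U : structure L) (A : set U) (n : nat)
    (c : 'I_n -> U) (psi : param_formula A n) :=
  sat (projT2 psi).1 (fcat c (fun i => val ((projT2 psi).2 i))).

Definition saturated (K : Type) (L : language) (U : structure L) :=
  forall A : set U, small K A ->
  forall (n : nat) (p : set (param_formula A n)),
    (forall q, finite_set q -> q `<=` p ->
       exists c : 'I_n -> U, forall psi, q psi -> psat c psi) ->
    exists c : 'I_n -> U, forall psi, p psi -> psat c psi.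

Definition automorphism (L : language) (U : structure L) (s : U -> U) :=
  [/\ bijective s,
      forall (f : fun_sym L) (v : 'I_(fun_ar f) -> U),
        s (interp_fun v) = interp_fun (s \o v) &
      forall (r : rel_sym L) (v : 'I_(rel_ar r) -> U),
        interp_rel v <-> interp_rel (s \o v)].

Definition partial_elementary (L : language) (U : structure L) (A : set U)
    (f : U -> U) :=
  forall (n : nat) (psi : formula L n) (v : 'I_n -> U),
    tuples A n v -> (sat psi v <-> sat psi (f \o v)).

Definition strongly_homogeneous (K : Type) (L : language) (U : structure L) :=
  forall (A : set U) (f : U -> U), small K A -> partial_elementary A f ->
    exists2 s : U -> U, automorphism s & forall a, A a -> s a = f a.

Definition monster_model (K : Type) (L : language) (T : set (sentence L))
    (U : structure L) :=
  [/\ models U T, card_lt [set: all_formulas L] [set: K],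
      saturated K U & strongly_homogeneous K U].

Inductive bcomb (I : Type) :=
| BTrue
| BAtom of I
| BNot of bcomb I
| BAnd of bcomb I & bcomb I
| BOr of bcomb I & bcomb I.

Fixpoint beval (I : Type) (P : I -> Prop) (c : bcomb I) : Prop :=
  match c with
  | BTrue => True
  | BAtom i => P i
  | BNot c => ~ beval P c
  | BAnd c d => beval P c /\ beval P d
  | BOr c d => beval P c \/ beval P d
  end.

(* A partitioned formula phi(x, y) with |x| = m and |y| = n is an element of
   [formula L (m + n)]. *)
Definition holds (L : language) (U : structure L) (m n : nat)
    (phi : formula L (m + n)) (a : 'I_m -> U) (b : 'I_n -> U) :=
  sat phi (fcat a b).

Definition NIP (L : language) (U : structure L) (m n : nat)
    (phi : formula L (m + n)) :=
  ~ exists B : set ('I_n -> U), infinite_set B /\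
      forall X Y, finite_set X -> finite_set Y -> X `<=` B -> Y `<=` B ->
        X `&` Y = set0 ->
        exists a : 'I_m -> U, (forall b, X b -> holds phi a b) /\
                              (forall b, Y b -> ~ holds phi a b).

Definition phi_formula (L : language) (U : structure L) (A : set U)
    (n : nat) := bcomb (tuples A n).

Definition phi_set (L : language) (U : structure L) (m n : nat)
    (phi : formula L (m + n)) (A : set U) (chi : phi_formula A n) :
    set ('I_m -> U) :=
  [set a | beval (fun b : tuples A n => holds phi a (val b)) chi].

Definition phi_definable (L : language) (U : structure L) (m n : nat)
    (phi : formula L (m + n)) (A : set U) : set (set ('I_m -> U)) :=
  range (phi_set phi (A := A)).

(* phi-formulas over A are identified with the subsets of U^x they define.
   Only the values of the measure on [phi_definable phi A] are meaningful;
   accordingly measures are compared by [agree_on]. *)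
Record phi_measure (R : realType) (L : language) (U : structure L) (m n : nat)
    (phi : formula L (m + n)) (A : set U) := PhiMeasure {
  pm_val :> set ('I_m -> U) -> R;
  pm_ge0 : forall D, phi_definable phi A D -> 0 <= pm_val D;
  pm_total : pm_val setT = 1;
  pm_additive : forall D E, phi_definable phi A D -> phi_definable phi A E ->
    D `&` E = set0 -> pm_val (D `|` E) = pm_val D + pm_val E }.

Definition agree_on (R : realType) (L : language) (U : structure L) (m n : nat)
    (phi : formula L (m + n)) (A : set U) (mu nu : set ('I_m -> U) -> R) :=
  forall D, phi_definable phi A D -> mu D = nu D.

Definition smooth_over (R : realType) (L : language) (U : structure L)
    (m n : nat) (phi : formula L (m + n))
    (nu : phi_measure R phi [set: U]) (A : set U) :=
  forall nu' : phi_measure R phi [set: U],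
    agree_on phi A nu' nu -> agree_on phi [set: U] nu' nu.

Definition smooth (K : Type) (R : realType) (L : language) (U : structure L)
    (m n : nat) (phi : formula L (m + n)) (nu : phi_measure R phi [set: U]) :=
  exists2 A : set U, small K A & smooth_over nu A.

(* A phi-generated formula theta(x, y_0, ..., y_(k-1)) is an element of
   [bcomb 'I_k], the atom i standing for phi(x, y_i). *)
Definition gholds (L : language) (U : structure L) (m n k : nat)
    (phi : formula L (m + n)) (theta : bcomb 'I_k)
    (a : 'I_m -> U) (b : 'I_k -> 'I_n -> U) :=
  beval (fun i => holds phi a (b i)) theta.

Definition triangle : bcomb 'I_2 :=
  let p := BAtom (ord0 : 'I_2) in let q := BAtom (ord_max : 'I_2) in
  BOr (BAnd p (BNot q)) (BAnd (BNot p) q).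

Definition pair2 (S : Type) (b c : S) : 'I_2 -> S :=
  fun i => if i == ord0 then b else c.

Section Stone.
Context (L : language) (U : structure L) (m n k : nat).
Context (phi : formula L (m + n)) (theta : bcomb 'I_k) (A : set U).

Definition dual_formula := bcomb (tuples A m).

Definition dual_holds (b : 'I_k -> 'I_n -> U) (chi : dual_formula) :=
  beval (fun a : tuples A m => gholds phi theta (val a) b) chi.

Record stone := Stone {
  stone_set : set dual_formula;
  stone_fin_sat : forall q, finite_set q -> q `<=` stone_set ->
    exists b, forall chi, q chi -> dual_holds b chi;
  stone_complete : forall chi, stone_set chi \/ stone_set (BNot chi) }.

Lemma stone_mem (p : stone) (q : set dual_formula) (chi : dual_formula) :
  finite_set q -> q `<=` stone_set p ->
  (forall b, (forall xi, q xi -> dual_holds b xi) -> dual_holds b chi) ->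
  stone_set p chi.
Proof.
move=> finq qp qchi; case: (stone_complete p chi) => // pN.
have [|xi [/qp//|->//]|b hb] := @stone_fin_sat p (q `|` [set BNot chi]).
  by rewrite finite_setU; split => //; exact: finite_set1.
have /= := hb _ (or_intror erefl); case; apply: qchi => xi qxi.
by apply: hb; left.
Qed.

Lemma stone_true (p : stone) : stone_set p (BTrue _).
Proof. by apply: (@stone_mem p set0). Qed.

Lemma stone_and (p : stone) chi xi : stone_set p (BAnd chi xi) <-> stone_set p chi /\ stone_set p xi.
Proof.
split=> [pa|[pc px]].
  have pa1 : [set BAnd chi xi] `<=` stone_set p by move=> _ ->.
  by split; apply: (stone_mem (finite_set1 _) pa1) => b /(_ _ erefl)[].
apply: (@stone_mem p [set chi; xi]).
- by rewrite finite_setU; split; exact: finite_set1.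
- by move=> _ [->|->].
- by move=> b hb; split; apply: hb; [left|right].
Qed.

HB.instance Definition _ := gen_eqMixin stone.
HB.instance Definition _ := gen_choiceMixin stone.

Definition stone_basic (chi : dual_formula) : set stone := [set p | stone_set p chi].

Definition stone_open (D : set stone) :=
  forall p, D p -> exists2 chi, stone_basic chi p & stone_basic chi `<=` D.

Lemma stone_openT : stone_open setT.
Proof. by move=> p _; exists (BTrue _) => //; exact: stone_true. Qed.

Lemma stone_openI D E : stone_open D -> stone_open E -> stone_open (D `&` E).
Proof.
move=> oD oE p [/oD[chi pc cD] /oE[xi px xE]]; exists (BAnd chi xi).
  exact/stone_and.
by move=> q /stone_and[/cD ? /xE].
Qed.

Lemma stone_open_bigU (I : Type) (F : I -> set stone) :
  (forall i, stone_open (F i)) -> stone_open (\bigcup_i F i).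
Proof.
move=> oF p [i _ /oF[chi pc cF]]; exists chi => // q /cF Fq.
by exists i.
Qed.

HB.instance Definition _ :=
  isOpenTopological.Build stone stone_openT stone_openI stone_open_bigU.

Definition dual_tp_set (b : 'I_k -> 'I_n -> U) : set dual_formula :=
  [set chi | dual_holds b chi].

Lemma dual_tp_fin_sat b q : finite_set q -> q `<=` dual_tp_set b ->
  exists b, forall chi, q chi -> dual_holds b chi.
Proof. by move=> _ qb; exists b. Qed.

Lemma dual_tp_complete b chi : dual_tp_set b chi \/ dual_tp_set b (BNot chi).
Proof. exact: (lem (dual_holds b chi)). Qed.

Definition dual_tp (b : 'I_k -> 'I_n -> U) : stone :=
  Stone (@dual_tp_fin_sat b) (@dual_tp_complete b).

End Stone.

(* The factor [f] of nu(theta(x, -)) through [dual_tp] is the induced map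
   S_{theta*}(A) -> [0,1]: when A is small every point of the Stone space is
   realized in the monster model, so f is determined by nu. *)
Definition strongly_definable_over (R : realType) (L : language)
    (U : structure L) (m n k : nat) (phi : formula L (m + n))
    (theta : bcomb 'I_k) (nu : phi_measure R phi [set: U]) (A : set U) :=
  exists f : stone phi theta A -> R,
    continuous f /\
    forall b : 'I_k -> 'I_n -> U,
      nu [set a | gholds phi theta a b] = f (dual_tp phi theta A b).

Definition strongly_definable (K : Type) (R : realType) (L : language)
    (U : structure L) (m n k : nat) (phi : formula L (m + n))
    (theta : bcomb 'I_k) (nu : phi_measure R phi [set: U]) :=
  exists2 A : set U, small K A & strongly_definable_over theta nu A.

Definition packing (R : realType) (L : language) (U : structure L) (m n : nat)
    (phi : formula L (m + n)) (N : set U) (mu : phi_measure R phi N)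
    (eps : R) : set nat :=
  [set l | exists b : 'I_l -> 'I_n -> U,
     (forall i, tuples N n (b i)) /\
     forall i j : 'I_l, (i < j)%N ->
       eps <= mu [set a | gholds phi triangle a (pair2 (b i) (b j))]].

Definition packing_number (R : realType) (L : language) (U : structure L)
    (m n : nat) (phi : formula L (m + n)) (N : set U)
    (mu : phi_measure R phi N) (eps : R) : \bar R :=
  ereal_sup [set l%:R%:E | l in packing mu eps].

(* Main.v *)
Require Import Defs.
From mathcomp Require Import all_boot all_order all_algebra.
From mathcomp Require Import all_classical all_reals all_analysis.
From mathcomp Require Import lra zify.
From Stdlib Require List.
Local Open Scope classical_set_scope.
Local Open Scope card_scope.
Local Open Scope ring_scope.

Import Order.TTheory GRing.Theory Num.Theory.
Import numFieldNormedType.Exports.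

(** (i) -> (ii): by saturation, NIP bounds the size of shattered sets, and a
    Sauer-Shelah argument bounds the number of instances at pairwise distance
    [eps], uniformly in the measure.  Two extensions of a measure on [A] that
    differ at an instance average to a measure for which that instance is far
    from all phi-formulas over [A]; this can only be repeated boundedly often,
    so adjoining countably many parameters to [M] makes an extension smooth.

    (ii) -> (iii): every instance is sandwiched between formulas over the small
    set on which the measure is smooth; by saturation finitely many sandwiches
    suffice for a given error, so the measure of the symmetric difference of two
    instances is a uniform limit of weighted averages over finitely many points.

    (iii) -> (iv): if the packing number is infinite, this is witnessed over an
    elementary submodel of size at most [|T|]; but near the type of a pair [(d, d)] the
    measure of the symmetric difference is close to [0], and two of sufficiently
    many instances form a pair whose type is near that point.

    (iv) -> (i): along an independent sequence, let the truth values be fair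
    coin tosses; the instances are then at distance [1/2]. *)

Set Implicit Arguments.
Unset Strict Implicit.
Unset Printing Implicit Defensive.

(** * Definable sets and saturation *)

Section Renaming.
Context (L : language) (U : structure L).

Fixpoint trename (n k : nat) (r : 'I_n -> 'I_k) (t : term L n) : term L k :=
  match t with
  | Var i => Var L (r i)
  | App f ts => App (fun i => trename r (ts i))
  end.

Definition rlift (n k : nat) (r : 'I_n -> 'I_k) : 'I_n.+1 -> 'I_k.+1 :=
  fun i => if unlift ord0 i is Some j then lift ord0 (r j) else ord0.

Fixpoint frename (n : nat) (psi : formula L n) :
    forall k, ('I_n -> 'I_k) -> formula L k :=
  match psi in formula _ n return forall k, ('I_n -> 'I_k) -> formula L k with
  | FBot _ => fun k _ => FBot L k
  | FEq _ s t => fun k r => FEq (trename r s) (trename r t)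
  | FRel _ R ts => fun k r => FRel (fun i => trename r (ts i))
  | FImp _ p q => fun k r => FImp (frename p r) (frename q r)
  | FAll _ p => fun k r => FAll (frename p (rlift r))
  end.

Lemma teval_rename n k (r : 'I_n -> 'I_k) (t : term L n) (v : 'I_k -> U) :
  teval v (trename r t) = teval (v \o r) t.
Proof. by elim: t => //= f ts IH; congr interp_fun; apply/funext. Qed.

Lemma scons0 (S : Type) n (d : S) (v : 'I_n -> S) : scons d v ord0 = d.
Proof. by rewrite /scons unlift_none. Qed.

Lemma sconsS (S : Type) n (d : S) (v : 'I_n -> S) j :
  scons d v (lift ord0 j) = v j.
Proof. by rewrite /scons liftK. Qed.

Lemma scons_rlift n k (r : 'I_n -> 'I_k) (d : U) (v : 'I_k -> U) :
  scons d v \o rlift r = scons d (v \o r).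
Proof.
apply/funext => i /=; rewrite /rlift; case: (unliftP ord0 i) => [j|] ->.
  by rewrite !sconsS.
by rewrite !scons0.
Qed.

Lemma sat_rename n (psi : formula L n) k (r : 'I_n -> 'I_k) (v : 'I_k -> U) :
  sat (frename psi r) v <-> sat psi (v \o r).
Proof.
elim: psi k r v => {n} [n|n s t|n R ts|n p IHp q IHq|n p IH] k r v //=.
- by rewrite !teval_rename.
- have -> : (fun i => teval v (trename r (ts i))) =
            (fun i => teval (v \o r) (ts i)) by
    apply/funext => i; rewrite teval_rename.
  by [].
- by split=> H /IHp/H/IHq.
- split=> H d.
    by rewrite -scons_rlift; apply/IH.
  by apply/IH; rewrite scons_rlift.
Qed.

End Renaming.

Lemma fcatl (S : Type) m n (a : 'I_m -> S) (b : 'I_n -> S) i :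
  fcat a b (lshift n i) = a i.
Proof. by rewrite /fcat (unsplitK (inl i)). Qed.

Lemma fcatr (S : Type) m n (a : 'I_m -> S) (b : 'I_n -> S) i :
  fcat a b (rshift m i) = b i.
Proof. by rewrite /fcat (unsplitK (inr i)). Qed.

Lemma comp_fcat (S S' : Type) m n (f : S -> S') (a : 'I_m -> S) (b : 'I_n -> S) :
  f \o fcat a b = fcat (f \o a) (f \o b).
Proof. by apply/funext => i; rewrite /fcat /=; case: fintype.split. Qed.

Section Definability.
Context (L : language) (U : structure L).

(* Allowing an arbitrary type [V] of variables turns substitutions of
   variables, and of parameters for variables, into plain reindexing. *)
Definition definable (V : Type) (D : set (V -> U)) :=
  exists k (psi : formula L k) (f : 'I_k -> V),
    forall v, D v <-> sat psi (v \o f).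

Lemma definable_eq (V : Type) (D E : set (V -> U)) :
  (forall v, D v <-> E v) -> definable D -> definable E.
Proof. by move=> DE; have -> : D = E by apply/predeqP. Qed.

Lemma definable_reindex (V W : Type) (g : V -> W) (D : set (V -> U)) :
  definable D -> definable [set w : W -> U | D (w \o g)].
Proof. by move=> [k [psi [f Df]]]; exists k, psi, (g \o f) => v; exact: Df. Qed.

Lemma definable_bot (V : Type) : definable (set0 : set (V -> U)).
Proof.
by exists 0%N, (FBot L 0), (fun i : 'I_0 => False_rect V (notF (ltn_ord i))).
Qed.

Lemma definable_imp (V : Type) (D E : set (V -> U)) :
  definable D -> definable E -> definable [set v : V -> U | D v -> E v].
Proof.
move=> [k [p [f Df]]] [l [q [g Eg]]].
exists (k + l)%N, (FImp (frename p (@lshift k l)) (frename q (@rshift k l))),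
  (fcat f g) => v.
have fl : (v \o fcat f g) \o lshift l (m:=k) = v \o f.
  by apply/funext => i /=; rewrite fcatl.
have fr : (v \o fcat f g) \o rshift k (n:=l) = v \o g.
  by apply/funext => i /=; rewrite fcatr.
split=> [H /sat_rename|/= H /Df].
  by rewrite fl => /Df/H/Eg ?; apply/sat_rename; rewrite fr.
by rewrite -fl => /sat_rename/H/sat_rename; rewrite fr => /Eg.
Qed.

Lemma definable_not (V : Type) (D : set (V -> U)) :
  definable D -> definable [set v : V -> U | ~ D v].
Proof. by move=> dD; apply: definable_imp dD (@definable_bot V). Qed.

Lemma definable_true (V : Type) : definable (setT : set (V -> U)).
Proof.
apply: definable_eq (definable_not (@definable_bot V)) => v.
by split => // _ [].
Qed.

Lemma definable_and (V : Type) (D E : set (V -> U)) :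
  definable D -> definable E -> definable [set v : V -> U | D v /\ E v].
Proof.
move=> dD dE; have := definable_not (definable_imp dD (definable_not dE)).
apply: definable_eq => v /=; split=> [H|[? ?]]; last by apply.
by apply: contrapT => DE; apply: H => Dv Ev; apply: DE.
Qed.

Lemma definable_or (V : Type) (D E : set (V -> U)) :
  definable D -> definable E -> definable [set v : V -> U | D v \/ E v].
Proof.
move=> dD dE; have := definable_imp (definable_not dD) dE.
apply: definable_eq => v /=; split=> [H|[]//].
by case: (lem (D v)) => [|/H]; [left|right].
Qed.

Lemma definable_beval (V I : Type) (P : I -> set (V -> U)) (c : bcomb I) :
  (forall i, definable (P i)) -> definable [set v : V -> U | beval (fun i => P i v) c].
Proof.
move=> dP; elim: c => /= [|i|c|c IHc d IHd|c IHc d IHd].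
- exact: definable_true.
- exact: dP.
- exact: definable_not.
- exact: definable_and.
- exact: definable_or.
Qed.

Lemma definable_forall1 (V : Type) (w : V) (D : set (V -> U)) :
  definable D ->
  definable [set v : V -> U | forall d, D (fun x => if `[< x = w >] then d else v x)].
Proof.
move=> [k [p [f Df]]].
(* All positions that [f] sends to [w] become the bound variable; the others are shifted past it. *)
pose r (i : 'I_k) : 'I_k.+1 := if `[< f i = w >] then ord0 else lift ord0 i.
exists k, (FAll (frename p r)), f => v /=.
have E d : scons d (v \o f) \o r =
    (fun x => if `[< x = w >] then d else v x) \o f.
  apply/funext => i /=; rewrite /r; case: ifP => _.
    by rewrite scons0.
  by rewrite sconsS.
by split=> H d; [apply/sat_rename; rewrite E; apply/Df|
  apply/Df; rewrite -E; apply/sat_rename].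
Qed.

(* Only the finitely many variables occurring in the formula defining [D] have
   to be quantified. *)
Lemma definable_forall (V : Type) (S : set V) (D : set (V -> U)) :
  definable D ->
  definable [set v : V -> U | forall u, D (fun x => if `[< S x >] then u x else v x)].
Proof.
move=> dD; have [k [p [f Df]]] := dD.
pose Q (s : seq V) := [set v : V -> U | forall u : V -> U,
  D (fun x => if `[< S x /\ List.In x s >] then u x else v x)].
suff dQ s : definable (Q s).
  apply: definable_eq (dQ [seq f i | i <- enum 'I_k]) => v.
  have inf i : List.In (f i) [seq f i | i <- enum 'I_k].
    apply: List.in_map; have := mem_enum 'I_k i.
    elim: (enum _) => //= j s IH; rewrite inE => /predU1P[->|/IH]; by [left|right].
  have E u : (fun x => if `[< S x /\ List.In x [seq f i | i <- enum 'I_k] >]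
                       then u x else v x) \o f =
             (fun x => if `[< S x >] then u x else v x) \o f.
    apply/funext => i /=; case: (asboolP (S (f i))) => h.
      by rewrite asboolT.
    by rewrite asboolF // => -[].
  by split=> H u; apply/Df; [rewrite -E|rewrite E]; apply/Df.
elim: s => [|w s IH].
  apply: definable_eq dD => v; split=> [Dv u|/(_ v)].
    by rewrite (_ : (fun x => _) = v) //; apply/funext => x; case: asboolP => // -[].
  by congr D; apply/funext => x; case: ifP.
case: (lem (S w)) => Sw; last first.
  apply: definable_eq IH => v; split=> H u; have := H u; congr D;
    apply/funext => x; congr (if _ then _ else _); apply/asbool_equiv_eq;
    split=> /=.
  - by move=> [? ?]; split => //; right.
  - by move=> [Sx [xw|//]]; move: Sx; rewrite -xw.
  - by move=> [Sx [xw|//]]; move: Sx; rewrite -xw.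
  - by move=> [? ?]; split => //; right.
apply: definable_eq (definable_forall1 w IH) => v; split=> H.
  move=> u; have := H (u w) u; congr D; apply/funext => x.
  case: (asboolP (S x /\ List.In x s)) => [[Sx xs]|nxs].
    by rewrite asboolT //; split => //; right.
  case: asboolP => [->|xw].
    by rewrite asboolT //; split => //; left.
  by rewrite asboolF // => -[Sx [/esym//|xs]]; apply: nxs.
move=> d u.
have := H (fun x => if `[< S x /\ List.In x s >] then u x else d); congr D.
apply/funext => x.
case: (asboolP (S x /\ List.In x s)) => [[Sx xs]|nxs].
  by rewrite asboolT //; split => //; right.
case: asboolP => [[Sx [xw|xs]]|nxw].
- by rewrite asboolT.
- by case: nxs.
- by rewrite asboolF // => xw; apply: nxw; split; [rewrite xw|left].
Qed.

Lemma definable_exists (V : Type) (S : set V) (D : set (V -> U)) :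
  definable D ->
  definable [set v : V -> U | exists u, D (fun x => if `[< S x >] then u x else v x)].
Proof.
move=> dD; have := definable_not (definable_forall S (definable_not dD)).
apply: definable_eq => v /=; split=> [H|[u Du] /(_ u)//].
by apply: contrapT => nD; apply: H => u Du; apply: nD; exists u.
Qed.

(** Quantify over the variables in the range of [inr], then reindex along a map from [V + W] to [V].
    That map needs a value on [W]; for empty [V] there is only one assignment, so the set is
    trivial. *)
Lemma definable_forall_sum (V W : Type) (D : set (V + W -> U)) :
  definable D -> definable [set v : V -> U | forall u : W -> U,
    D (fun x => match x with inl a => v a | inr b => u b end)].
Proof.
move=> dD; case: (pselect (inhabited V)) => [[v0]|nV].
  pose g (x : V + W) := if x is inl a then a else v0.
  have := definable_reindex g (definable_forall (range inr) dD).
  apply: definable_eq => v; split=> /= [H u|H u].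
    have := H (fun x => if x is inr b then u b else v v0); congr D.
    apply/funext => -[a|b]; case: asboolP => //; first by case.
    by case; exists b.
  have := H (fun b => u (inr b)); congr D.
  apply/funext => -[a|b]; case: asboolP => //; first by case.
  by case; exists b.
have vv (v v' : V -> U) : v = v'.
  by apply/funext => x; case: nV.
set S := [set v | _]; case: (lem (S !=set0)) => [[v Sv]|nS].
  by apply: definable_eq (@definable_true V) => v'; split=> // _; rewrite (vv v' v).
apply: definable_eq (@definable_bot V) => v'; split=> // Sv'.
by case: nS; exists v'.
Qed.

Lemma definable_exists_sum (V W : Type) (D : set (V + W -> U)) :
  definable D -> definable [set v : V -> U | exists u : W -> U,
    D (fun x => match x with inl a => v a | inr b => u b end)].
Proof.
move=> dD; have := definable_not (definable_forall_sum (definable_not dD)).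
apply: definable_eq => v /=; split=> [H|[u Du] /(_ u)//].
by apply: contrapT => nD; apply: H => u Du; apply: nD; exists u.
Qed.

Lemma definable_all (V : Type) (I : finType) (D : I -> set (V -> U)) :
  (forall i, definable (D i)) -> definable [set v : V -> U | forall i, D i v].
Proof.
move=> dD; pose Q (s : seq I) := [set v : V -> U | forall i, i \in s -> D i v].
suff dQ s : definable (Q s).
  apply: (definable_eq _ (dQ (enum I))) => v.
  by split=> H i; [apply: H; rewrite mem_enum|move=> _; exact: H].
elim: s => [|j s IH].
  by apply: definable_eq (@definable_true V) => v; split.
apply: definable_eq (definable_and (dD j) IH) => v; split=> [[Dj H] i|H].
  by rewrite inE => /predU1P[->//|]; exact: H.
by split=> [|i si]; apply: H; rewrite inE ?eqxx // si orbT.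
Qed.

Lemma definable_holds m n (phi : formula L (m + n)) (V : Type)
    (x : 'I_m -> V) (y : 'I_n -> V) :
  definable [set v : V -> U | holds phi (v \o x) (v \o y)].
Proof.
by exists (m + n)%N, phi, (fcat x y) => v; rewrite /holds comp_fcat.
Qed.

(** Parameters enter as extra variables, each element of [A] being a variable evaluated at
    itself. *)
Definition definable_over (A : set U) n (D : set ('I_n -> U)) :=
  exists E : set ('I_n + A -> U), definable E /\
    forall c, D c <-> E (fun x => match x with inl i => c i | inr a => val a end).

Lemma definable_over_psat (A : set U) n (D : set ('I_n -> U)) :
  definable_over A D ->
  exists psi : param_formula A n, forall c, D c <-> psat c psi.
Proof.
move=> [E [[k [p [f Ef]]] DE]].
case: (pselect (inhabited A)) => [[a0]|nA].
  (* Every position gets a parameter slot; those occupied by a variable are filled with the dummy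
     [a0]. *)
  pose r i : 'I_(n + k) :=
    match f i with inl j => lshift k j | inr _ => rshift n i end.
  pose g i := match f i with inl _ => a0 | inr a => a end.
  exists (existT _ k (frename p r, g)) => c; rewrite DE Ef /psat /=.
  rewrite sat_rename; suff -> : fcat c (fun i => val (g i)) \o r =
    (fun x => match x with inl i => c i | inr a => val a end) \o f by [].
  apply/funext => i /=; rewrite /r; case fE : (f i) => [j|a].
    by rewrite fcatl.
  by rewrite fcatr /g fE.
pose r i : 'I_(n + 0) :=
  match f i with inl j => lshift 0 j | inr a => False_rect _ (nA (inhabits a)) end.
pose g (i : 'I_0) := False_rect A (notF (ltn_ord i)).
exists (existT _ 0%N (frename p r, g)) => c; rewrite DE Ef /psat /=.
rewrite sat_rename; suff -> : fcat c (fun i => val (g i)) \o r =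
  (fun x => match x with inl i => c i | inr a => val a end) \o f by [].
apply/funext => i /=; rewrite /r.
by case: (f i) => [j|a]; [rewrite fcatl|case: (nA (inhabits a))].
Qed.

(** Saturation for families of sets instead of sets of formulas: finitely many formulas are traced
    back to finitely many indices by choosing one index for each formula. *)
Lemma saturated_definable (K : Type) (A : set U) n (I : Type)
    (D : I -> set ('I_n -> U)) :
  saturated K U -> small K A -> (forall i, definable_over A (D i)) ->
  (forall s : set I, finite_set s -> exists c, forall i, s i -> D i c) ->
  exists c, forall i, D i c.
Proof.
move=> satU smA dD finD.
have /choice[psi psiD] i := definable_over_psat (dD i).
have [q finq qp|c cp] := satU A smA n (range psi).
  have /choice[g gP] (xi : param_formula A n) :
      exists o : option I, q xi -> if o is Some i then psi i = xi else False.
    case: (lem (q xi)) => [/[dup] /qp[i _ pi] _|nq]; last by exists None.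
    by exists (Some i).
  have [c cD] := finD (Some @^-1` (g @` q))
    (finite_preimage (in2W (@Some_inj _)) (finite_image _ finq)).
  exists c => xi qxi; have := gP xi qxi; case gx: (g xi) => [i|//] <-.
  by apply/psiD/cD; exists xi.
by exists c => i; apply/psiD/cp; exists i.
Qed.

End Definability.

Lemma finite_nat_bound (s : set nat) :
  finite_set s -> exists N, forall j, s j -> (j < N)%N.
Proof.
move=> /finite_seqP[l ->]; exists (\max_(j <- l) j).+1 => j.
by rewrite ltnS => jl; exact: (leq_bigmax_seq (F := id)).
Qed.

Lemma embedding_card_le (S S' : Type) (A : set S) (B : set S') (f : S -> S') :
  (forall x, A x -> B (f x)) -> {in A &, injective f} -> A #<= B.
Proof.
move=> AB /inj_card_eq/card_eqPle[_ /card_le_trans]; apply.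
by apply: subset_card_le => _ [x /AB Bfx <-].
Qed.

Lemma card_le_embedding (S S' : Type) (A : set S) (B : set S') :
  A #<= B -> exists f : A -> B, injective f.
Proof. by move=> /card_leP[f]; exists f => a b /inj; apply; exact: mem_setT. Qed.

(* If [M] is infinite, it contains a copy of [nat], whose even and odd parts
   absorb that copy and [C] respectively. *)
Lemma card_le_setU_countable (S : Type) (M C : set S) :
  infinite_set M -> countable C -> M `|` C #<= M.
Proof.
move=> /infiniteP /card_le_embedding[j jinj] /card_le_embedding[c cinj].
pose J k : S := val (j (exist _ k (mem_setT k))).
have JM k : M (J k) by apply: set_mem; exact: valP.
have Jinj : injective J by move=> k l /val_inj/jinj[].
pose h x := if pselect (exists k, J k = x) is left e then J (projT1 (cid e)).*2
  else if pselect (C x) is left Cx then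
    if `[< M x >] then x else J (val (c (exist _ x (mem_set Cx)))).*2.+1
  else x.
have hM x : (M `|` C) x -> M (h x).
  rewrite /h; case: pselect => // _; case: pselect => [Cx|nCx] [] // Mx.
    by case: asboolP.
  by case: asboolP.
have odd2 k l : k.*2 <> l.*2.+1.
  by move=> e; have := congr1 odd e; rewrite /= !odd_double.
apply: (embedding_card_le hM) => x y /set_mem xMC /set_mem yMC; rewrite /h.
case: (pselect (exists k, J k = x)) => [ex|nx];
  case: (pselect (exists k, J k = y)) => [ey|ny].
- case: (cid ex) => k ek; case: (cid ey) => l el /= /Jinj/double_inj kl.
  by rewrite -ek -el kl.
- case: (pselect (C y)) => [Cy|nCy].
    by case: asboolP => [My e|nMy /Jinj/odd2//]; case: ny; eexists; exact: e.
  by move=> e; case: ny; eexists; exact: e.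
- case: (pselect (C x)) => [Cx|nCx].
    case: asboolP => [Mx e|nMx /esym/Jinj/odd2//].
    by case: nx; rewrite e; eexists.
  by move=> e; by case: nx; rewrite e; eexists.
- case: (pselect (C x)) => [Cx|nCx]; case: (pselect (C y)) => [Cy|nCy].
  + case: asboolP => Mx; case: asboolP => My //.
    * by move=> e; by case: nx; rewrite e; eexists.
    * by move=> e; case: ny; eexists; exact: e.
    * move=> /Jinj[] /double_inj e.
      by have /cinj[] := val_inj e.
  + case: asboolP => // Mx e.
    by case: ny; eexists; exact: e.
  + case: asboolP => // My e.
    by case: nx; rewrite e; eexists.
  + by [].
Qed.

(** * Cardinality of parameter sets *)

Section Small.
Context (K : Type) (L : language) (U : structure L).
Hypothesis hK : card_lt [set: all_formulas L] [set: K].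

Lemma small_card_le (S : Type) (A : set S) :
  A #<= [set: all_formulas L] -> small K A.
Proof.
move=> AF; case: hK => FK nKF; split; first exact: card_le_trans FK.
by move=> KA; apply: nKF; exact: card_le_trans AF.
Qed.

Lemma small_countable (S : Type) (A : set S) : countable A -> small K A.
Proof.
move=> cA; apply: small_card_le; apply: card_le_trans cA _.
apply: (@embedding_card_le _ _ _ _ (fun k => existT _ k (FBot L k))) => // k l _ _.
by move=> /(congr1 (@projT1 _ _)).
Qed.

Lemma small_setU_countable (S : Type) (M C : set S) :
  small K M -> countable C -> small K (M `|` C).
Proof.
move=> smM cC; case: (lem (finite_set M)) => finM.
  apply: small_countable; rewrite -bigcup2E; apply: bigcup_countable => //.
  by move=> [|[|i]] _ //=; exact: finite_set_countable.
have MC := card_le_setU_countable finM cC; case: smM => MK nKM.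
split; first exact: card_le_trans MK.
by move=> KMC; apply: nKM; exact: card_le_trans MC.
Qed.

End Small.

(** * Compactness in countably many variables *)

Section CountableCompactness.
Context (K : Type) (L : language) (U : structure L).
Hypothesis hK : card_lt [set: all_formulas L] [set: K].
Hypothesis satU : saturated K U.

(** [saturated] only realizes types in finitely many variables, so the coordinates are chosen one at
    a time, the earlier ones serving as countably many parameters. *)
Lemma definable_chain_nat (G : nat -> set (nat -> U)) :
  (forall N, definable (G N)) -> (forall N, G N.+1 `<=` G N) ->
  (forall N, G N !=set0) -> exists v, forall N, G N v.
Proof.
move=> dG Gdecr Gn0.
have Gle N N' : (N <= N')%N -> G N' `<=` G N.
  by elim: N' => [|N' IH]; [rewrite leqn0 => /eqP->|rewrite leq_eqVlt =>
    /predU1P[->//|/IH] GG v /Gdecr /GG].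
(* Invariant of the construction: the first [i] coordinates of [d] can still be completed inside
   every [G N]. *)
pose Good i (d : nat -> U) :=
  forall N, exists u, G N (fun k => if (k < i)%N then d k else u k).
have step (p : nat * (nat -> U)) : exists c, Good p.1 p.2 ->
    Good p.1.+1 (fun k => if k == p.1 then c else p.2 k).
  case: p => i d /=; case: (lem (Good i d)) => gd; last first.
    by case: (carrier_inhabited U) => u0; exists u0.
  pose D N : set ('I_1 -> U) := [set c | exists u, G N (fun k =>
    if (i < k)%N then u k else if k == i then c ord0 else d k)].
  have cA : countable (range d) by exact: card_image_le.
  have [N|s fins|c cD] := saturated_definable (D := D) satU
      (small_countable hK cA).
  - have rd k : d k \in range d by apply/mem_set; exists k.
    pose g k : 'I_1 + range d :=
      if k == i then inl ord0 else inr (exist _ (d k) (rd k)).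
    exists [set v | exists u, G N (fun k => if `[< (i < k)%N >] then u k
                                            else v (g k))]; split.
      exact: (definable_reindex g (definable_exists [set k | (i < k)%N] (dG N))).
    move=> c; rewrite /D /=; split=> -[u Gu]; exists u; move: Gu; congr G;
      apply/funext => k; rewrite ?asboolb; case: ifP => // _; rewrite /g;
      by case: ifP.
  - have [N sN] : exists N, forall j, s j -> (j <= N)%N.
      by have [N sN] := finite_nat_bound fins; exists N => j /sN/ltnW.
    have [u Gu] := gd N; exists (fun _ => u i) => j /sN jN.
    exists u; apply: (Gle _ _ jN); move: Gu; congr G; apply/funext => k.
    by case: ltngtP => // ->.
  exists (c ord0) => _ N; have [u Gu] := cD N; exists u; move: Gu; congr G.
  by apply/funext => k; rewrite ltnS; case: ltngtP.
have [c cP] := choice step.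
pose dd := fix dd i := match i with
  | 0 => fun=> inhabited_witness (carrier_inhabited U)
  | i.+1 => fun k => if k == i then c (i, dd i) else dd i k end.
have good i : Good i (dd i).
  elim: i => [N|i IH]; last exact: (cP (i, dd i) IH).
  by have [u Gu] := Gn0 N; exists u; move: Gu; congr G; apply/funext.
have ddE i k : (k < i)%N -> dd i k = dd k.+1 k.
  elim: i => // i IH; rewrite ltnS leq_eqVlt => /predU1P[->//|ki] /=.
  by rewrite (ltn_eqF ki) IH //= eqxx.
(* [G N] depends on finitely many coordinates only, so it does not distinguish the diagonal sequence
   from a completion of a long enough initial segment. *)
exists (fun k => dd k.+1 k) => N; have [l [p [f Gf]]] := dG N.
have [u /Gf] := good (\max_(i < l) (f i).+1) N; rewrite Gf.
congr sat; apply/funext => i /=.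
have h : (f i < \max_(i < l) (f i).+1)%N by exact: (leq_bigmax i).
by rewrite h ddE //= eqxx.
Qed.

Lemma definable_chain (V : countType) (G : nat -> set (V -> U)) :
  (forall N, definable (G N)) -> (forall N, G N.+1 `<=` G N) ->
  (forall N, G N !=set0) -> exists v, forall N, G N v.
Proof.
move=> dG Gdecr Gn0.
have [N|N v|N|v Gv] := @definable_chain_nat (fun N => [set v : nat -> U | G N (v \o pickle)]).
- exact: definable_reindex.
- exact: Gdecr.
- have [v Gv] := Gn0 N; case: (carrier_inhabited U) => u0.
  exists (fun k => if unpickle k is Some x then v x else u0) => /=.
  by move: Gv; congr G; apply/funext => x /=; rewrite pickleK.
- by exists (v \o pickle).
Qed.

End CountableCompactness.

(** * Finitely additive measures *)

Section Charges.
Context (R : realType) (X : Type).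
Implicit Types (A : set (set X)) (mu P Q : set X -> R) (D E F C : set X).

Definition set_algebra A :=
  [/\ A setT, forall D, A D -> A (~` D) & forall D E, A D -> A E -> A (D `&` E)].

Definition charge_on A mu :=
  [/\ forall D, A D -> 0 <= mu D, mu setT = 1 &
      forall D E, A D -> A E -> D `&` E = set0 -> mu (D `|` E) = mu D + mu E].

(** Measures on all subsets spare the membership conditions; by [charge_on_extension] every measure
    on an algebra is the restriction of one. *)
Definition charge P := charge_on setT P.

Lemma set_algebraT : set_algebra setT. Proof. by []. Qed.

Section AlgebraTheory.
Variables (A : set (set X)) (mu : set X -> R).
Hypotheses (hA : set_algebra A) (hmu : charge_on A mu).

Lemma set_algebraU D E : A D -> A E -> A (D `|` E).
Proof.
by case: hA => _ Ac AI AD AE; rewrite -[_ `|` _]setCK setCU; apply/Ac/AI; apply: Ac.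
Qed.

Lemma set_algebraD D E : A D -> A E -> A (D `\` E).
Proof. by case: hA => _ Ac AI AD AE; rewrite setDE; apply: AI => //; apply: Ac. Qed.

Lemma set_algebra0 : A set0.
Proof. by case: hA => AT Ac _; rewrite -setCT; apply: Ac. Qed.

Lemma charge_on_split D E : A D -> A E -> mu D = mu (D `&` E) + mu (D `\` E).
Proof.
move=> AD AE; case: hmu hA => _ _ add [_ _ AI]; rewrite -add ?setUIDK //.
- exact: AI.
- exact: set_algebraD.
- by apply/seteqP; split=> // x [[_ Ex] [_ /(_ Ex)]].
Qed.

Lemma charge_on_ge0 D : A D -> 0 <= mu D.
Proof. by case: hmu => + _ _; apply. Qed.

Lemma charge_on_set0 : mu set0 = 0.
Proof.
have := charge_on_split set_algebra0 set_algebra0.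
by rewrite setI0 set0D => /eqP; rewrite addrC -subr_eq subrr => /eqP.
Qed.

Lemma charge_on_le D E : A D -> A E -> D `<=` E -> mu D <= mu E.
Proof.
move=> AD AE DE; rewrite (charge_on_split AE AD) (setIidr DE) lerDl.
by apply/charge_on_ge0/set_algebraD.
Qed.

Lemma charge_on_setC D : A D -> mu (~` D) = 1 - mu D.
Proof.
case: hmu hA => _ mT _ [AT _ _] AD.
by rewrite -mT (charge_on_split AT AD) setTI setTD addrAC subrr add0r.
Qed.

Lemma charge_on_le1 D : A D -> mu D <= 1.
Proof. by move=> AD; case: hmu hA => _ <- _ [AT _ _]; apply: charge_on_le. Qed.

Lemma charge_onU_le D E : A D -> A E -> mu (D `|` E) <= mu D + mu E.
Proof.
move=> AD AE; have AU := set_algebraU AD AE; rewrite (charge_on_split AU AD).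
rewrite (setIidr (@subsetUl _ D E)) setDUl setDv set0U lerD2l.
by apply: charge_on_le => //; exact: set_algebraD.
Qed.

Lemma charge_on_dist D E F : A D -> A E -> A F ->
  D `\` E `<=` F -> E `\` D `<=` F -> `|mu D - mu E| <= mu F.
Proof.
move=> AD AE AF DEF EDF.
have := charge_on_split AE AD; have := charge_on_split AD AE.
rewrite [E `&` D]setIC.
have := charge_on_le (set_algebraD AD AE) AF DEF.
have := charge_on_le (set_algebraD AE AD) AF EDF.
have := charge_on_ge0 (set_algebraD AD AE).
have := charge_on_ge0 (set_algebraD AE AD).
by rewrite ler_norml; lra.
Qed.

End AlgebraTheory.

Definition wsum (s : seq (R * X)) D : R := \sum_(p <- s) p.1 * (`[< D p.2 >])%:R.

Lemma wsum_ge0 s D : all (fun p => 0 <= p.1) s -> 0 <= wsum s D.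
Proof.
rewrite /wsum; elim: s => [|p s IH] /=; first by rewrite big_nil.
by move=> /andP[p0 /IH s0]; rewrite big_cons addr_ge0 // mulr_ge0.
Qed.

Lemma wsum_cat s t D : wsum (s ++ t) D = wsum s D + wsum t D.
Proof. by rewrite /wsum big_cat. Qed.

Lemma wsumU s D E : D `&` E = set0 -> wsum s (D `|` E) = wsum s D + wsum s E.
Proof.
move=> DE0; rewrite /wsum -big_split /=; apply: eq_bigr => p _.
rewrite -mulrDr -natrD; congr (_ * _%:R).
case: (asboolP (D p.2)) => [Dp|nD]; case: (asboolP (E p.2)) => [Ep|nE].
- by have : (D `&` E) p.2 by []; rewrite DE0.
- by rewrite asboolT //; left.
- by rewrite asboolT //; right.
- by rewrite asboolF // => -[].
Qed.

Lemma charge_wsum s : all (fun p => 0 <= p.1) s -> wsum s setT = 1 -> charge (wsum s).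
Proof.
by move=> s0 s1; split=> // [D _|D E _ _]; [exact: wsum_ge0|exact: wsumU].
Qed.

(* One point is picked in each nonempty atom of the algebra generated by [l],
   inside [D] whenever the atom meets [D]. *)
Lemma charge_on_finite_approx A mu (l : seq (set X)) C D :
  set_algebra A -> charge_on A mu -> (forall E, E \in l -> A E) -> A C ->
  exists s, [/\ all (fun p => 0 <= p.1) s,
    forall E, E `&` C = set0 -> wsum s E = 0,
    wsum s C = mu C,
    forall E, E \in l -> wsum s E = mu (E `&` C) &
    exists F, [/\ A F, D `&` C `<=` F & mu F <= wsum s D]].
Proof.
move=> hA hmu; elim: l C => [|E l IH] C Al Ac.
  have single x : C x -> forall E, wsum [:: (mu C, x)] E = mu C * (`[< E x >])%:R.
    by move=> Cx E; rewrite /wsum big_seq1.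
  have mC := charge_on_ge0 hmu Ac.
  have Cdisj x E : C x -> E `&` C = set0 -> wsum [:: (mu C, x)] E = 0.
    move=> Cx EC; rewrite single // asboolF ?mulr0 // => Ex.
    by have : (E `&` C) x by []; rewrite EC.
  (* One point carries the whole mass of [C]. It is taken in [D] if possible; otherwise [D] misses
     [C] and [F] is empty. *)
  case: (lem (exists x, (D `&` C) x)) => [[x [Dx Cx]]|nDC].
    exists [:: (mu C, x)]; split=> //=.
    - by rewrite mC.
    - by move=> E; exact: Cdisj.
    - by rewrite single // asboolT ?mulr1.
    - by exists C; split => //; rewrite ?single // ?asboolT // mulr1.
  have DC0 : D `&` C `<=` set0 by move=> x DCx; apply: nDC; exists x.
  case: (lem (exists x, C x)) => [[x Cx]|nC].
    exists [:: (mu C, x)]; split=> //=.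
    - by rewrite mC.
    - by move=> E; exact: Cdisj.
    - by rewrite single // asboolT ?mulr1.
    - exists set0; split=> //; first exact: set_algebra0.
      by rewrite (charge_on_set0 hA hmu) single // mulr_ge0.
  have C0 : C = set0 by apply/seteqP; split => // x Cx; apply: nC; exists x.
  exists [::]; split=> //.
  - by move=> E _; rewrite /wsum big_nil.
  - by rewrite C0 (charge_on_set0 hA hmu) /wsum big_nil.
  - exists set0; split=> //; first exact: set_algebra0.
    by rewrite (charge_on_set0 hA hmu) /wsum big_nil.
have AE : A E by apply: Al; rewrite inE eqxx.
have Al' F : F \in l -> A F by move=> Fl; apply: Al; rewrite inE Fl orbT.
have [AT ACo AI] := hA.
(* The next set [E] splits [C], and the points found in the two halves are put together. The second
   conclusion keeps each half from charging the other. *)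
have ACE := AI _ _ Ac AE; have ACD := set_algebraD hA Ac AE.
have [s [s0 sdisj sC sl [F [AF DF sF]]]] := IH _ Al' ACE.
have [t [t0 tdisj tC tl [G [AG DG tG]]]] := IH _ Al' ACD.
have subI0 (B B' : set X) : B `<=` B' -> forall B2, B2 `&` B' = set0 -> B2 `&` B = set0.
  by move=> BB B2 e; apply/seteqP; split=> // x [? /BB ?]; rewrite -e.
have sE : wsum s (C `\` E) = 0.
  by apply: sdisj; apply/seteqP; split=> // x [[_ nE] [_ /nE]].
have tE : wsum t (C `&` E) = 0.
  by apply: tdisj; apply/seteqP; split=> // x [[_ Ex] [_ /(_ Ex)]].
exists (s ++ t); split.
- by rewrite all_cat s0.
- move=> B BC; rewrite wsum_cat sdisj ?tdisj ?addr0 //.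
    by apply: subI0 BC => x [].
  by apply: subI0 BC => x [].
- rewrite wsum_cat -{1 2}(setUIDK C E) !wsumU ?sE ?tE ?sC ?tC; last 2 first.
    by apply/seteqP; split=> // x [[_ Ex] [_ /(_ Ex)]].
    by apply/seteqP; split=> // x [[_ Ex] [_ /(_ Ex)]].
  by rewrite addr0 add0r -(charge_on_split hA hmu Ac AE).
- move=> B; rewrite inE => /predU1P[->|Bl].
    rewrite wsum_cat [wsum t E]tdisj ?addr0; last first.
      by apply/seteqP; split=> // x [Ex [_ /(_ Ex)]].
    rewrite -(setUIDK E C) wsumU ?[wsum s (E `\` C)]sdisj.
    + by rewrite addr0 setIC sC setIUl setIC; congr mu; apply/seteqP; split=> x /=; tauto.
    + by apply/seteqP; split=> // x [[_ nC] []].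
    + by apply/seteqP; split=> // x [[_ Cx] [_ /(_ Cx)]].
  have AB := Al' _ Bl; rewrite wsum_cat sl // tl //.
  rewrite (charge_on_split hA hmu (AI _ _ AB Ac) AE) setIA; congr (_ + mu _).
  by rewrite setDE setDE setIA.
- exists (F `|` G); split; first exact: set_algebraU.
    move=> x [Dx Cx]; case: (lem (E x)) => Ex; [left; exact: DF|right; exact: DG].
  rewrite wsum_cat; apply: le_trans (charge_onU_le hA hmu AF AG) _.
  exact: lerD.
Qed.

Lemma charge_on_finite_approxT A mu (l : seq (set X)) D :
  set_algebra A -> charge_on A mu -> (forall E, E \in l -> A E) ->
  exists s, [/\ all (fun p => 0 <= p.1) s, wsum s setT = 1,
    forall E, E \in l -> wsum s E = mu E &
    exists F, [/\ A F, D `<=` F & mu F <= wsum s D]].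
Proof.
move=> hA hmu Al; have AT : A setT by case: hA.
have [s [s0 _ sT sl [F [AF DF sF]]]] := charge_on_finite_approx D hA hmu Al AT.
exists s; split=> //.
- by rewrite sT; case: hmu.
- by move=> E /sl ->; rewrite setIT.
- by exists F; split=> //; rewrite -[D]setIT.
Qed.

(** A substitute for integrating the sum of indicators: for a finitely supported measure with the
    same values on the [E w], the sums can be exchanged. *)
Lemma charge_sum_le P (W : finType) (E : W -> set X) c : charge P ->
  (forall x, \sum_w (`[< E w x >])%:R <= c) -> \sum_w P (E w) <= c.
Proof.
move=> hP Ec; have [s [s0 sT sl _]] :=
  charge_on_finite_approxT (l := [seq E w | w <- enum W]) set0 set_algebraT hP
    (fun _ _ => I).
have -> : \sum_w P (E w) = \sum_w wsum s (E w).
  by apply: eq_bigr => w _; rewrite sl // map_f // mem_enum.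
rewrite [leRHS](_ : c = wsum s setT * c); last by rewrite sT mul1r.
rewrite /wsum exchange_big /= mulr_suml.
elim: s s0 {sT sl} => [|p s IH] /=; first by rewrite !big_nil.
move=> /andP[p0 /IH s0]; rewrite !big_cons lerD //.
by rewrite -mulr_sumr asboolT // mulr1; apply: ler_wpM2l.
Qed.

(** The limit is taken along an ultrafilter refining [FF], where it exists since the values lie in
    the compact interval [[0, 1]]. Closed bounds pass to the limit; with [a = b] they give the
    values that are eventually constant. *)
Lemma charge_ultralimit (I : Type) (FF : set_system I) (P : I -> set X -> R) :
  ProperFilter FF -> (forall i, charge (P i)) ->
  exists2 Q, charge Q &
    forall D a b, FF [set i | a <= P i D <= b] -> a <= Q D <= b.
Proof.
move=> FFP hP; have [G [Gu FG]] := ultraFilterLemma FFP.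
have GP : ProperFilter G by exact: ultra_proper.
have lim D : exists q : R, P^~ D @ G --> q.
  have P01 : G (P^~ D @^-1` [set` `[0, 1]]).
    apply: filterE => i /=; rewrite in_itv /=.
    by rewrite (charge_on_ge0 (hP i)) // (charge_on_le1 set_algebraT (hP i)).
  have [q [_ qcl]] := @segment_compact R 0 1 _ (fmap_proper_filter _ _) P01.
  exists q => V Vq; case: (in_ultra_setVsetC (P^~ D @^-1` V) Gu) => // GV.
  by have [x []] := qcl (~` V) V GV Vq.
have [Q QP] := choice lim.
have Qle D a b : FF [set i | a <= P i D <= b] -> a <= Q D <= b.
  move=> /FG Gab; apply/andP; split.
    apply: (@closed_cvg _ _ G GP (P^~ D) [set x | a <= x]) (QP D).
      exact: closed_ge.
    by apply: filterS Gab => i /= /andP[].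
  apply: (@closed_cvg _ _ G GP (P^~ D) [set x | x <= b]) (QP D).
    exact: closed_le.
  by apply: filterS Gab => i /= /andP[].
exists Q => //; split.
- move=> D _; suff /andP[] : 0 <= Q D <= 1 by [].
  apply: Qle; apply: filterE => i /=.
  by rewrite (charge_on_ge0 (hP i)) // (charge_on_le1 set_algebraT (hP i)).
- apply/esym/eqP; rewrite eq_le; apply: Qle.
  by apply: filterE => i /=; case: (hP i) => _ -> _; rewrite lexx.
- move=> D E _ _ DE; apply: cvg_unique (QP (D `|` E)) _ => //.
  have -> : P^~ (D `|` E) = P^~ D \+ P^~ E.
    by apply/funext => i /=; case: (hP i) => _ _ ->.
  exact: cvgD.
Qed.

(** An ultralimit of finitely supported measures indexed by the lists of sets to be measured
    exactly. The last clause says that [D] gets at least its outer measure; this comes from placing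
    the support points in [D] whenever possible. *)
Lemma charge_on_extension A mu D : set_algebra A -> charge_on A mu ->
  exists Q, [/\ charge Q, forall E, A E -> Q E = mu E &
    forall r, (forall F, A F -> D `<=` F -> r <= mu F) -> r <= Q D].
Proof.
move=> hA hmu.
pose FF : set_system (seq (set X)) :=
  filter_from setT (fun l0 : seq (set X) => [set l | {subset l0 <= l}]).
have FFP : ProperFilter FF.
  apply: filter_from_proper; last by move=> l _; exists l.
  apply: filter_from_filter; first by exists [::].
  move=> l1 l2 _ _; exists (l1 ++ l2) => // l h; split=> E El; apply: h;
    by rewrite mem_cat El ?orbT.
have /choice[s sP] (l : seq (set X)) : exists s, [/\ all (fun p => 0 <= p.1) s,
    wsum s setT = 1, forall E, A E -> E \in l -> wsum s E = mu E &
    exists F, [/\ A F, D `<=` F & mu F <= wsum s D]].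
  have [E|s [s0 sT sl sF]] := charge_on_finite_approxT
      (l := [seq E <- l | `[< A E >]]) D hA hmu.
    by rewrite mem_filter => /andP[/asboolP].
  by exists s; split=> // E AE El; apply: sl; rewrite mem_filter El asboolT.
have hP l : charge (wsum (s l)) by case: (sP l) => s0 sT _ _; exact: charge_wsum.
have [Q hQ Qle] := charge_ultralimit FFP hP; exists Q; split=> //.
- move=> E AE; apply/esym/eqP; rewrite eq_le; apply: Qle.
  exists [:: E] => // l /(_ E); rewrite inE eqxx => /(_ isT) El /=.
  by case: (sP l) => _ _ /(_ E AE El) -> _; rewrite lexx.
- move=> r rP; suff /andP[] : r <= Q D <= 1 by [].
  apply: Qle; exists [::] => // l _ /=.
  rewrite (charge_on_le1 set_algebraT (hP l)) // andbT.
  by case: (sP l) => _ _ _ [F [AF DF /(le_trans _)]]; apply; exact: rP.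
Qed.

(** One extension gives [D] its outer measure, and another does so for the complement, which gives
    [D] its inner measure. Uniqueness at [D] makes the two coincide. *)
Lemma charge_on_sandwich A mu D e : set_algebra A -> charge_on A mu ->
  (forall P Q, charge P -> charge Q -> (forall E, A E -> P E = mu E) ->
     (forall E, A E -> Q E = mu E) -> P D = Q D) ->
  0 < e -> exists E F, [/\ A E, A F, E `<=` D, D `<=` F & mu (F `\` E) < e].
Proof.
move=> hA hmu uniqD e0.
have [P [hP PA Ple]] := charge_on_extension D hA hmu.
have [Q [hQ QA Qle]] := charge_on_extension (~` D) hA hmu.
have approx (S : set X) (q : R) : ~ (q <= q - e / 2) ->
    ((forall F, A F -> S `<=` F -> q + e / 2 <= mu F) -> q + e / 2 <= q) ->
    exists F, [/\ A F, S `<=` F & mu F < q + e / 2].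
  move=> _ qS; apply: contrapT => nF.
  have : q + e / 2 <= q.
    apply: qS => F AF SF; rewrite leNgt; apply/negP => h.
    by apply: nF; exists F.
  by rewrite gerDl leNgt divr_gt0.
have ne (q : R) : ~ (q <= q - e / 2).
  by rewrite lerBrDr gerDl leNgt divr_gt0.
have [F [AF DF mF]] := approx D (P D) (ne _) (Ple _).
have [G [AG DG mG]] := approx (~` D) (Q (~` D)) (ne _) (Qle _).
have [_ ACo _] := hA; exists (~` G), F; split=> //; first exact: ACo.
  by move=> x nGx; apply: contrapT => /DG.
have PQ := uniqD _ _ hP hQ PA QA.
move: mG; rewrite (charge_on_setC set_algebraT hQ) // -PQ => mG.
have := charge_on_split hA hmu AF (ACo _ AG).
have := charge_on_setC hA hmu AG.
have -> : F `&` ~` G = ~` G.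
  by apply/seteqP; split=> [x []//|x nGx]; split=> //; apply: DF; apply: contrapT => /DG.
lra.
Qed.

End Charges.

(** * Shattering and packing *)

Section Shattering.
Variable T : finType.
Implicit Types (F : {set {set T}}) (S B : {set T}).

Definition shatters F S :=
  [forall B : {set T}, (B \subset S) ==> [exists A in F, A :&: S == B]].

Lemma shattersP F S : reflect
  (forall B, B \subset S -> exists2 A, A \in F & A :&: S = B) (shatters F S).
Proof.
apply: (iffP forallP) => h B.
  by move=> BS; have /exists_inP[A AF /eqP] := implyP (h B) BS; exists A.
apply/implyP => /h[A AF AS]; apply/exists_inP; exists A => //; exact/eqP.
Qed.

Lemma shatters_sub F F' S : F \subset F' -> shatters F S -> shatters F' S.
Proof.
move=> /fintype.subsetP FG /shattersP h; apply/shattersP => B /h[A /FG AG AS].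
by exists A.
Qed.

(* Pajor's strengthening of the Sauer-Shelah lemma. *)
Lemma card_le_shattered F : (#|F| <= #|[set S | shatters F S]%SET|)%N.
Proof.
have [k] := ubnP #|F|; elim: k F => // k IH F; rewrite ltnS => Fk.
case: (leqP #|F| 1) => F1.
  case: (posnP #|F|) => [->//|F0]; apply: leq_trans F1 _.
  case/card_gt0P: F0 => A AF; rewrite card_gt0; apply/set0Pn; exists finset.set0.
  rewrite inE; apply/shattersP => B; rewrite finset.subset0 => /eqP ->.
  by exists A => //; rewrite finset.setI0.
have /card_gt1P[A [A' [AF A'F AA']]] := F1.
(* Two distinct members differ at some [x], so splitting [F] by membership of [x] gives two smaller
   families. *)
have [x xA] : exists x, (x \in A) != (x \in A').
  case: (pickP (fun x => (x \in A) != (x \in A'))) => [x xA|h]; first by exists x.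
  by case/eqP: AA'; apply/finset.setP => x; have /negbFE/eqP := h x.
pose Fx := [set B : {set T} | x \in B]%SET.
have FI := cardsID Fx F.
have [FIk FDk] : (#|F :&: Fx| < k /\ #|F :\: Fx| < k)%N.
  have I0 : (0 < #|F :&: Fx|)%N.
    apply/card_gt0P; case xA1 : (x \in A); [exists A|exists A'];
      by move: xA; rewrite !inE xA1 ?AF ?A'F //; case: (x \in A').
  have D0 : (0 < #|F :\: Fx|)%N.
    apply/card_gt0P; case xA1 : (x \in A); [exists A'|exists A];
      by move: xA; rewrite !inE xA1 ?AF ?A'F //; case: (x \in A').
  split; apply: leq_trans Fk; rewrite -FI.
    by rewrite -[X in (X < _)%N]addn0 ltn_add2l.
  by rewrite -[X in (X < _)%N]add0n ltn_add2r.
have {IH} := leq_add (IH _ FIk) (IH _ FDk); rewrite FI => /leq_trans; apply.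
set s1 := [set S | shatters (F :&: Fx) S]%SET.
set s0 := [set S | shatters (F :\: Fx) S]%SET.
have s1x S : S \in s1 -> x \notin S.
  rewrite inE => /shattersP/(_ finset.set0 (finset.sub0set _))[B].
  rewrite !inE => /andP[_ xB] /finset.setP/(_ x).
  by rewrite !inE xB /= => ->.
have s0x S : S \in s0 -> x \notin S.
  rewrite inE => /shattersP h; apply/negP => xS.
  have [|B] := h [set x]%SET; first by rewrite finset.sub1set.
  rewrite !inE => /andP[xB _] /finset.setP/(_ x).
  by rewrite !inE eqxx (negbTE xB).
have injx : {in s1 :&: s0 &, injective (fun S => x |: S)%SET}.
  move=> S S'; rewrite !inE => /andP[Ss1 _] /andP[S's1 _] /finset.setP e.
  have xS : x \notin S by apply: s1x; rewrite inE.
  have xS' : x \notin S' by apply: s1x; rewrite inE.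
  apply/finset.setP => y; have := e y; rewrite !inE.
  by case: eqP => // -> _; rewrite (negbTE xS) (negbTE xS').
(* Both halves shatter only sets avoiding [x]. A set shattered by both is counted twice, and it
   accounts for itself and for its union with [x]. *)
rewrite -cardsUI -(card_in_imset injx) -cardsUI.
rewrite [X in (_ + X)%N](_ : _ = 0%N) ?addn0; last first.
  apply/eqP; rewrite cards_eq0; apply/eqP/finset.setP => S; rewrite [RHS]finset.in_set0.
  apply/negP; rewrite finset.in_setI => /andP[+ /imsetP[S' _ SS']].
  rewrite finset.in_setU => /orP[/s1x|/s0x]; by rewrite SS' !inE eqxx.
apply: subset_leq_card; apply/fintype.subsetP => S.
rewrite finset.in_setU => /orP[|/imsetP[S' + ->]].
  rewrite !inE => /orP[]; apply: shatters_sub; [exact: finset.subsetIl|exact: finset.subsetDl].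
rewrite !inE => /andP[/shattersP h1 /shattersP h0]; apply/shattersP => B BS.
case: (boolP (x \in B)) => xB.
  have [|C] := h1 (B :\ x)%SET.
    by apply/fintype.subsetP => y; rewrite !inE => /andP[yx /(fintype.subsetP BS)];
      rewrite !inE (negbTE yx).
  rewrite !inE => /andP[CF xC] /finset.setP e; exists C => //.
  apply/finset.setP => y; have := e y; rewrite !inE.
  by case: eqP => // ->; rewrite xC xB.
have [|C] := h0 B.
  apply/fintype.subsetP => y yB; have := fintype.subsetP BS _ yB; rewrite !inE.
  by case: eqP => // yx; move: xB; rewrite -yx yB.
rewrite !inE => /andP[xC CF] /finset.setP e; exists C => //.
apply/finset.setP => y; have := e y; rewrite !inE.
by case: eqP => // ->; rewrite (negbTE xC) (negbTE xB).
Qed.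

End Shattering.

(** A set of at most [d] elements is the range of a map from ['I_d], with [None] as padding. *)
Lemma card_small_sets k d : (#|[set S : {set 'I_k} | #|S| <= d]%SET| <= k.+1 ^ d)%N.
Proof.
pose g (h : {ffun 'I_d -> option 'I_k}) : {set 'I_k} :=
  [set t | [exists i, h i == Some t]]%SET.
have -> : (k.+1 ^ d)%N = #|{ffun 'I_d -> option 'I_k}|.
  by rewrite card_ffun card_option !card_ord.
apply: leq_trans (leq_imset_card g _); apply: subset_leq_card.
apply/fintype.subsetP => S; rewrite inE => Sd; apply/imsetP.
exists [ffun i : 'I_d => onth (enum S) i] => //; apply/finset.setP => t.
rewrite inE; apply/idP/existsP => [tS|[i]]; last first.
  by rewrite ffunE => /eqP e; rewrite -mem_enum; apply/onthP; exists i.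
have iS : (index t (enum S) < size (enum S))%N by rewrite index_mem mem_enum.
have id : (index t (enum S) < d)%N by apply: leq_trans iS _; rewrite -cardE.
exists (Ordinal id); rewrite ffunE /= onthE (nth_map t) //.
by rewrite nth_index ?mem_enum.
Qed.

Definition shattered (X Y : Type) (E : X -> Y -> Prop) (d : nat) :=
  exists b : 'I_d -> Y, forall C : {set 'I_d}, exists x, forall i,
    E x (b i) <-> i \in C.

(* A set of [2 ^ d] points [x] shattered by the [y]'s yields [d] points [y]
   shattered by the [x]'s. *)
Lemma shattered_traces (X Y : Type) (E : X -> Y -> Prop) (d k N : nat)
    (a : 'I_k -> X) (b : 'I_N -> Y) :
  (k.+1 ^ (2 ^ d) < N)%N ->
  (forall i j : 'I_N, (i < j)%N -> exists t, ~ (E (a t) (b i) <-> E (a t) (b j))) ->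
  shattered E d.
Proof.
move=> kN sep; pose A (j : 'I_N) := [set t | `[< E (a t) (b j) >]]%SET.
have Ainj : injective A.
  have lt (i j : 'I_N) : (i < j)%N -> A i <> A j.
    move=> /sep[t nE] /finset.setP/(_ t); rewrite !inE => e; apply: nE.
    by split=> h; apply/asboolP; [rewrite -e|rewrite e]; apply/asboolP.
  move=> i j AA; apply/val_inj => /=; case: (ltngtP i j) => // ij.
    by case: (lt _ _ ij).
  by case: (lt _ _ ij).
have := card_le_shattered [set A j | j in 'I_N]%SET.
rewrite card_imset // card_ord => Nsh.
have [S SA dS] : exists2 S, shatters [set A j | j in 'I_N]%SET S & (2 ^ d < #|S|)%N.
  apply: contrapT => nS; have := leq_trans kN Nsh; rewrite ltnNge => /negP; apply.
  apply: leq_trans (card_small_sets k (2 ^ d)); apply/subset_leq_card.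
  apply/fintype.subsetP => S; rewrite !inE => sh; rewrite leqNgt.
  by apply/negP => dS; apply: nS; exists S.
have gP (C : {set 'I_d}) : (enum_rank C < #|S|)%N.
  apply: leq_trans (ltn_ord _) _.
  by rewrite -cardsT -powersetT card_powerset cardsT card_ord; exact: ltnW.
pose g C : 'I_k := enum_val (Ordinal (gP C)).
have gS C : g C \in S by exact: enum_valP.
have ginj : injective g.
  by move=> C C' /enum_val_inj[] /ord_inj/enum_rank_inj.
(* The points [g C] of [S] are labelled by the subsets of ['I_d]; the trace of [b (j i)] selects the
   labels containing [i]. *)
have /choice[j jP] (i : 'I_d) : exists j, A j :&: S = [set g C | C in {set 'I_d} & i \in C]%SET.
  have [|B /imsetP[j _ ->] AS] := shattersP _ _ SA [set g C | C in {set 'I_d} & i \in C]%SET.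
    by apply/fintype.subsetP => t /imsetP[C _ ->].
  by exists j.
exists (b \o j) => C; exists (a (g C)) => i /=.
have /finset.setP/(_ (g C)) := jP i; rewrite !inE gS andbT => e.
split=> [/asboolP|iC]; last first.
  by apply/asboolP; rewrite e; apply/imsetP; exists C; rewrite ?inE.
by rewrite e => /imsetP[C' + /ginj ->]; rewrite inE.
Qed.

(** Makes [2 ^ t] instances too many for the traces that [c * t] points admit when shattering is
    bounded. *)
Lemma exp_beats_poly (c d : nat) : exists2 t, (0 < t)%N & ((c * t).+1 ^ d < 2 ^ t)%N.
Proof.
(* The left side is at most [2 ^ ((c + 6 * z) * d)], whose exponent is at most [7 * z ^ 2], and this
   lies below [t = (2 ^ z) ^ 6]. *)
pose z := (c + d).+1; exists (2 ^ (6 * z))%N; first by rewrite expn_gt0.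
have le1 : ((c * 2 ^ (6 * z)).+1 <= 2 ^ (c + 6 * z))%N.
  have := ltn_expl c (isT : 1 < 2)%N; have : (0 < 2 ^ (6 * z))%N by rewrite expn_gt0.
  by rewrite expnD; nia.
apply: (@leq_ltn_trans ((2 ^ (c + 6 * z)) ^ d)).
  by case: (posnP d) => [->|d0] //; rewrite leq_exp2r.
rewrite -expnM ltn_exp2l //.
have -> : (2 ^ (6 * z) = (2 ^ z) * (2 ^ z) * (2 ^ z * 2 ^ z * (2 ^ z * 2 ^ z)))%N.
  by rewrite -!expnD; congr (2 ^ _)%N; lia.
have := ltn_expl z (isT : 1 < 2)%N; move: (2 ^ z)%N => w zw.
have w2 : (2 <= w)%N by rewrite /z in zw *; lia.
have w4 : (4 <= w * w)%N by nia.
have w16 : (16 <= w * w * (w * w))%N by nia.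
have zz : ((c + 6 * z) * d <= 7 * (z * z))%N by rewrite /z; nia.
have zw2 : (z * z < w * w)%N by nia.
by nia.
Qed.

Definition symd (X : Type) (D E : set X) := (D `\` E) `|` (E `\` D).

(** * Separating distant sets by few points *)

Section Packing.
Variables (R : realType) (X : Type) (P : set X -> R).
Hypothesis hP : charge P.

Lemma charge_inhabited : exists x : X, True.
Proof.
apply: contrapT => nX; have := charge_on_set0 (@set_algebraT X) hP.
rewrite (_ : set0 = setT); last by apply/seteqP; split=> // x; case: nX; exists x.
by case: hP => _ -> _ /eqP; rewrite oner_eq0.
Qed.

(** By averaging: if every point lay in too few of the [E w], then [charge_sum_le] would bound their
    total measure by half of what it is at least. *)
Lemma greedy_point (W : finType) (V : {set W}) (E : W -> set X) (eps : R) :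
  0 < eps -> (forall w, w \in V -> eps <= P (E w)) ->
  exists x, eps / 2 * #|V|%:R <= \sum_(w in V) (`[< E w x >])%:R.
Proof.
move=> eps0 EP; apply: contrapT => nx.
have lt x : \sum_(w in V) (`[< E w x >])%:R < eps / 2 * #|V|%:R.
  by rewrite ltNge; apply/negP => h; apply: nx; exists x.
pose F w := if w \in V then E w else set0.
have F0 x : (`[< set0 x >] : bool)%:R = 0 :> R by rewrite asboolF.
have le1 : \sum_w P (F w) <= eps / 2 * #|V|%:R.
  apply: (charge_sum_le hP) => x; rewrite (bigID (mem V)) /= addrC big1 ?add0r.
    rewrite (eq_bigr (fun w => (`[< E w x >])%:R)); first exact: ltW.
    by move=> w wV; rewrite /F wV.
  by move=> w wV; rewrite /F (negbTE wV).
have le2 : eps * #|V|%:R <= \sum_w P (F w).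
  rewrite (bigID (mem V)) /= -[leLHS]addr0 lerD //; last first.
    by apply: sumr_ge0 => w _; exact: (charge_on_ge0 hP).
  rewrite mulr_natr -sumr_const; apply: ler_sum => w wV.
  by rewrite /F wV; exact: EP.
have [x _] := charge_inhabited; have := lt x.
have : 0 <= \sum_(w in V) (`[< E w x >])%:R :> R by exact: sumr_ge0.
lra.
Qed.

(* Each new point separates a proportion at least [eps / 2] of the pairs that
   are not yet separated. *)
Lemma greedy_separation (N : nat) (D : 'I_N -> set X) (eps : R) : 0 < eps <= 1 ->
  (forall i j : 'I_N, (i < j)%N -> eps <= P (symd (D i) (D j))) ->
  forall k, exists a : 'I_k -> X,
    #|[set p : 'I_N * 'I_N | (p.1 < p.2)%N &&
       [forall t, `[< ~ symd (D p.1) (D p.2) (a t) >]]]%SET|%:R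
    <= (1 - eps / 2) ^+ k * (N ^ 2)%:R :> R.
Proof.
move=> /andP[eps0 eps1] DP; elim=> [|k [a IH]].
  have [x _] := charge_inhabited; exists (fun=> x).
  rewrite expr0 mul1r ler_nat; apply: leq_trans (max_card _) _.
  by rewrite card_prod card_ord -mulnn.
set V := [set p | _]%SET in IH.
have [w wV|x xV] := @greedy_point _ V (fun p => symd (D p.1) (D p.2)) _ eps0.
  by apply: DP; move: wV; rewrite inE => /andP[].
exists (fun t => if unlift ord0 t is Some t' then a t' else x).
set V' := [set p | _]%SET.
have V'V p : p \in V' -> p \in V.
  rewrite !inE => /andP[-> /forallP h] /=.
  by apply/forallP => t; have := h (lift ord0 t); rewrite liftK.
have VV : #|V'|%:R + \sum_(w in V) (`[< symd (D w.1) (D w.2) x >])%:R <= #|V|%:R :> R.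
  rewrite -natr_sum -natrD ler_nat -!sum1_card big_mkcond.
  rewrite [X in (_ + X)%N]big_mkcond -big_split /= [leqRHS]big_mkcond.
  apply: leq_sum => p _; case: (boolP (p \in V')) => [pV'|_].
    rewrite (V'V _ pV'); move: pV'; rewrite inE.
    move=> /andP[_ /forallP/(_ ord0)]; rewrite unlift_none.
    by move=> /asboolP ns; rewrite asboolF.
  by case: ifP => // _; case: `[< _ >].
have q0 : 0 <= 1 - eps / 2 by lra.
apply: (@le_trans _ _ ((1 - eps / 2) * #|V|%:R)); first by lra.
by rewrite exprS -mulrA ler_wpM2l.
Qed.

End Packing.

(** Among [2 ^ t] instances, [c * t] greedily chosen points leave fewer than one pair unseparated,
    hence none. So many distinct traces on so few points force shattering. The number [N] is chosen
    before the measure. *)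
Lemma packing_shattered (R : realType) (X Y : Type) (E : X -> Y -> Prop)
    (d : nat) (eps : R) : 0 < eps ->
  exists N, forall (P : set X -> R) (b : 'I_N -> Y), charge P ->
    (forall i j : 'I_N, (i < j)%N ->
       eps <= P (symd (E^~ (b i)) (E^~ (b j)))) ->
    shattered E d.
Proof.
move=> eps0; pose e := Num.min eps 1.
have e01 : 0 < e <= 1 by rewrite lt_min eps0 ltr01 ge_min lexx orbT.
(* Each block of [c] points divides the bound on the unseparated pairs by 8, while [2 ^ t] instances
   form at most [4 ^ t] pairs. *)
have [c cP] : exists c, (1 - e / 2) ^+ c <= 8^-1 :> R.
  have q1 : `|1 - e / 2| < 1 :> R by rewrite ger0_norm; lra.
  have /cvgrPdist_lt/(_ 8^-1) := cvg_expr q1; rewrite invr_gt0 ltr0n => /(_ isT)[c _ h].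
  exists c; have := h c (leqnn c); rewrite /= sub0r normrN => /ltW.
  by apply: le_trans; exact: ler_norm.
have [t t0 tP] := exp_beats_poly c (2 ^ d); exists (2 ^ t)%N => P b hP bP.
have [i j ij|a aP] := greedy_separation hP (D := fun i => E^~ (b i)) e01 _ (c * t).
  by apply: le_trans (bP i j ij); rewrite ge_min lexx.
apply: (shattered_traces (a := a) (b := b) tP) => i j ij; apply: contrapT => nsep.
move: aP; apply/negP; rewrite -ltNge.
apply: (@lt_le_trans _ _ 1).
  rewrite exprM; apply: (@le_lt_trans _ _ (8^-1 ^+ t * ((2 ^ t) ^ 2)%:R)).
    apply: ler_wpM2r => //; apply: lerXn2r => //; rewrite nnegrE ?exprn_ge0 //;
      lra.
  rewrite -expnM mulnC expnM natrX -exprMn exprn_ilt1 ?lt0n_neq0 //; lra.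
rewrite ler1n card_gt0; apply/set0Pn; exists (i, j); rewrite inE /= ij.
apply/forallP => s; apply/asboolP => sd; apply: nsep; exists s => -[h h'].
by case: sd => -[? n]; apply: n; auto.
Qed.

(** * Phi-formulas and NIP *)

Section NIP.
Context (K : Type) (L : language) (U : structure L).
Hypothesis hK : card_lt [set: all_formulas L] [set: K].
Hypothesis satU : saturated K U.
Context (m n : nat) (phi : formula L (m + n)).

(** Being shattered is a definable condition on the first [N] terms of a sequence, so
    [definable_chain] turns arbitrarily long shattered families into one infinite sequence. *)
Lemma shattered_not_NIP :
  (forall d, shattered (holds (U := U) phi) d) -> ~ NIP U phi.
Proof.
move=> sh; apply; pose y (v : nat * 'I_n -> U) k : 'I_n -> U := fun j => v (k, j).
pose G N := [set v : nat * 'I_n -> U | forall C : {set 'I_N}, exists a : 'I_m -> U,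
  forall i : 'I_N, holds phi a (y v i) <-> i \in C].
have dG N : definable (G N).
  apply: definable_all => C.
  apply: (definable_exists_sum (W := 'I_m)
    (D := [set w | forall i : 'I_N, holds phi (fun j => w (inr j))
       (fun j => w (inl (nat_of_ord i, j))) <-> i \in C])).
  apply: definable_all => i; have dh := definable_holds U phi
    (inr : 'I_m -> (nat * 'I_n) + 'I_m) (fun j => inl (nat_of_ord i, j)).
  case: (boolP (i \in C)) => iC; [move: dh|move: (definable_not dh)];
    apply: definable_eq => w /=.
    by split=> [|[_]]//; apply.
  by split=> [//|[h _] /h].
have GP N v (C : nat -> Prop) : G N v ->
    exists a, forall i, (i < N)%N -> holds phi a (y v i) <-> C i.
  move=> /(_ [set i : 'I_N | `[< C i >]]%SET)[a aP]; exists a => i iN.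
  rewrite -[i]/(nat_of_ord (Ordinal iN)) aP inE.
  by split=> [/asboolP|?]; last exact/asboolP.
have [N|N v Gv C|N|v Gv] := definable_chain hK satU (G := G).
- exact: dG.
- have [a aP] := GP _ _ (fun k => exists2 i : 'I_N, nat_of_ord i = k & i \in C) Gv.
  exists a => i; rewrite aP; last exact: (ltnW (ltn_ord i)).
  by split=> [[j /ord_inj ->]//|iC]; exists i.
- have [b bP] := sh N; case: (carrier_inhabited U) => u0.
  exists (fun p => if insub p.1 is Some i then b i p.2 else u0) => C.
  have [a aP] := bP C; exists a => i; rewrite -aP.
  suff -> : y (fun p => if insub p.1 is Some i then b i p.2 else u0) i = b i by [].
  by apply/funext => j; rewrite /y /= valK.
(* The terms are distinct because some [a] satisfies the instance at [k] but not the one at [l]. *)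
have yinj : injective (y v).
  move=> k l ykl; apply: contrapT => kl.
  have [a aP] := GP (maxn k l).+1 v (eq k) (Gv _).
  have := aP l; have := aP k; rewrite ykl !ltnS leq_maxl leq_maxr.
  by move=> [] // h1 h2 [] // h3 h4; apply/kl/h3/h2.
exists (range (y v)); split.
  apply/infiniteP; apply: (embedding_card_le (f := y v)) => [x _|]; last first.
    by move=> k l _ _; exact: yinj.
  by exists x.
move=> X Y finX finY XB YB XY.
have finXY : finite_set (X `|` Y) by rewrite finite_setU.
have [N sN] := finite_nat_bound (finite_preimage (in2W yinj) finXY).
have [a aP] := GP N v (fun k => X (y v k)) (Gv _).
exists a; split=> b.
  move=> /[dup] Xb /XB[k _ yb]; rewrite -yb aP; first by rewrite yb.
  by apply: sN; left; rewrite yb.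
move=> /[dup] Yb /YB[k _ yb]; rewrite -yb aP; last by apply: sN; right; rewrite yb.
by rewrite yb => Xb; have : (X `&` Y) b by []; rewrite XY.
Qed.

Lemma NIP_packing (R : realType) (eps : R) : NIP U phi -> 0 < eps ->
  exists N, forall (P : set ('I_m -> U) -> R) (b : 'I_N -> 'I_n -> U),
    charge P -> ~ (forall i j : 'I_N, (i < j)%N ->
       eps <= P (symd (holds phi ^~ (b i)) (holds phi ^~ (b j)))).
Proof.
move=> nip eps0.
have [d nd] : exists d, ~ shattered (holds (U := U) phi) d.
  apply: contrapT => nd; apply: shattered_not_NIP nip => d.
  by apply: contrapT => sd; apply: nd; exists d.
have [N NP] := packing_shattered (holds (U := U) phi) d eps0.
by exists N => P b hP bP; apply: nd; exact: NP hP bP.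
Qed.

End NIP.

(** * The algebra of phi-formulas and its measures *)

Section PhiAlgebra.
Context (R : realType) (L : language) (U : structure L).
Context (m n : nat) (phi : formula L (m + n)).
Notation inst b := (fun a => holds (U := U) phi a b).

Lemma phi_algebra (A : set U) : set_algebra (phi_definable phi A).
Proof.
split=> [|D [c _ <-]|D E [c _ <-] [d _ <-]].
- by exists (BTrue _) => //; apply/predeqP => a; split.
- by exists (BNot c).
- by exists (BAnd c d).
Qed.

Lemma phi_definable_inst (A : set U) b : tuples A n b ->
  phi_definable phi A (inst b).
Proof. by move=> Ab; exists (BAtom (exist _ b (mem_set Ab))). Qed.

Lemma phi_definable_ind (A : set U) (Q : set ('I_m -> U) -> Prop) :
  Q setT -> (forall b, tuples A n b -> Q (inst b)) ->
  (forall D, Q D -> Q (~` D)) -> (forall D E, Q D -> Q E -> Q (D `&` E)) ->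
  forall D, phi_definable phi A D -> Q D.
Proof.
move=> QT Qb QC QI D [c _ <-]; elim: c => [|b|c Qc|c Qc d Qd|c Qc d Qd].
- by rewrite (_ : phi_set _ _ = setT) //; apply/predeqP => a; split.
- by apply: Qb; apply: set_mem; exact: valP.
- exact: QC.
- exact: QI.
- rewrite (_ : phi_set _ _ = ~` (~` phi_set phi c `&` ~` phi_set phi d)).
    by apply: (QC); apply: QI; apply: QC.
  by rewrite setCI !setCK.
Qed.

Lemma phi_definable_sub (A B : set U) : A `<=` B ->
  phi_definable phi A `<=` phi_definable phi B.
Proof.
move=> AB; have [BT BC BI] := phi_algebra B.
by apply: phi_definable_ind => // b Ab; apply: phi_definable_inst => i; apply/AB/Ab.
Qed.

Lemma phi_measure_charge (A : set U) (mu : phi_measure R phi A) :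
  charge_on (phi_definable phi A) mu.
Proof. by case: mu => mu mu0 mu1 muD; split. Qed.

Lemma phi_measure_restrict (A : set U) (nu : phi_measure R phi [set: U]) :
  charge_on (phi_definable phi A) nu.
Proof.
have [nu0 nu1 nuD] := phi_measure_charge nu; have sub := phi_definable_sub (@subsetT _ A).
by split=> // [D /sub/nu0|D E /sub TD /sub TE]//; exact: nuD.
Qed.

Definition charge_phi_measure (A : set U) (P : set ('I_m -> U) -> R)
    (hP : charge P) : phi_measure R phi A :=
  @PhiMeasure R L U m n phi A P
    (fun D _ => let: And3 h _ _ := hP in h D I)
    (let: And3 _ h _ := hP in h)
    (fun D E _ _ => let: And3 _ _ h := hP in h D E I I).

(** The error is enclosed in a set [F] over [A] so that every measure agreeing with [mu] over [A]
    sees the same small error. Boolean operations at most unite the error sets. *)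
Lemma phi_approximable (A : set U) (mu : set ('I_m -> U) -> R) (e : R) :
  charge_on (phi_definable phi A) mu ->
  (forall b e, 0 < e -> exists E F, [/\ phi_definable phi A E,
     phi_definable phi A F, E `<=` inst b, inst b `<=` F & mu (F `\` E) < e]) ->
  0 < e -> forall D, phi_definable phi setT D -> exists E F,
    [/\ phi_definable phi A E, phi_definable phi A F, symd D E `<=` F & mu F < e].
Proof.
move=> hmu sand e0 D Ddef; have hA := phi_algebra A; have [AT Ac AI] := hA.
move: D Ddef e e0; apply: phi_definable_ind.
- move=> e e0; exists setT, set0; split=> //; first exact: set_algebra0.
    by move=> x [[_ []]|[_ []]].
  by rewrite (charge_on_set0 hA hmu).
- move=> b _ e /(sand b)[E [F [AE AF EF bF lt]]]; exists E, (F `\` E); split=> //.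
    exact: set_algebraD.
  by move=> x [[/bF Fx nE]|[/EF bx nb]].
- move=> D IH e /IH[E [F [AE AF DE lt]]]; exists (~` E), F; split=> //.
    exact: Ac.
  move=> x [[nD nE]|[nE nD]]; apply: DE; [right|left]; split=> //.
    exact: contrapT.
  exact: contrapT.
- move=> D D' IH IH' e e0; have e2 : 0 < e / 2 by rewrite divr_gt0.
  have [E [F [AE AF DE lt]]] := IH _ e2.
  have [E' [F' [AE' AF' DE' lt']]] := IH' _ e2.
  exists (E `&` E'), (F `|` F'); split.
  + exact: AI.
  + exact: set_algebraU.
  + move=> x [[[Dx Dx'] nE]|[[Ex Ex'] nD]].
      case: (lem (E x)) => Ex; last by left; apply: DE; left.
      by right; apply: DE'; left; split=> // Ex'; apply: nE.
    case: (lem (D x)) => Dx; last by left; apply: DE; right.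
    by right; apply: DE'; right; split=> // Dx'; apply: nD.
  + by have := charge_onU_le hA hmu AF AF'; lra.
Qed.

Lemma smooth_sandwich (A : set U) (nu : phi_measure R phi setT) b e :
  (forall nu' : phi_measure R phi setT, agree_on phi A nu' nu ->
     nu' (inst b) = nu (inst b)) -> 0 < e ->
  exists E F, [/\ phi_definable phi A E, phi_definable phi A F,
    E `<=` inst b, inst b `<=` F & nu (F `\` E) < e].
Proof.
move=> uniqb; apply: charge_on_sandwich (phi_measure_restrict A nu) _; first exact: phi_algebra.
move=> P Q hP hQ PA QA.
have /= -> := uniqb (charge_phi_measure setT hP) PA.
by have /= -> := uniqb (charge_phi_measure setT hQ) QA.
Qed.

(* Since the instances generate the algebra, uniqueness on them suffices. *)
Lemma smooth_overP (A : set U) (nu : phi_measure R phi setT) :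
  (forall (nu' : phi_measure R phi setT) b, agree_on phi A nu' nu ->
     nu' (inst b) = nu (inst b)) -> smooth_over nu A.
Proof.
move=> uniqi nu' nu'A D TD.
have sub := phi_definable_sub (@subsetT _ A).
have nuA := phi_measure_restrict A nu.
apply/eqP; rewrite -subr_eq0 -normr_eq0 eq_le normr_ge0 andbT.
apply/ler_addgt0Pl => e e0; rewrite addr0.
have e2 : 0 < e / 2 by rewrite divr_gt0.
have [|E [F [AE AF DEF lt]]] := phi_approximable nuA _ e2 TD.
  by move=> b e' e'0; apply: smooth_sandwich => // nu'' h; exact: uniqi.
have h (rho : phi_measure R phi setT) : agree_on phi A rho nu ->
    `|rho D - nu E| < e / 2.
  move=> rhoA; rewrite -(rhoA _ AE); apply: le_lt_trans lt; rewrite -(rhoA _ AF).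
  apply: (charge_on_dist (phi_algebra setT) (phi_measure_charge rho)) => //.
  - exact: sub.
  - exact: sub.
  - by move=> x h; apply: DEF; left.
  - by move=> x h; apply: DEF; right.
have := h nu' nu'A; have := h nu (fun _ _ => erefl).
by rewrite !ltr_norml ler_norml => /andP[? ?] /andP[? ?]; apply/andP; split; lra.
Qed.

End PhiAlgebra.

(** * Smooth extensions *)

Section SmoothExtension.
Context (R : realType) (K : Type) (L : language) (U : structure L).
Hypothesis hK : card_lt [set: all_formulas L] [set: K].
Hypothesis satU : saturated K U.
Context (m n : nat) (phi : formula L (m + n)).
Notation inst b := (fun a => holds (U := U) phi a b).
Implicit Types (A : set U) (P : set ('I_m -> U) -> R).

(** Uniqueness of the extension at instances up to an error [e]. The bound is one-sided because [P1]
    and [P2] can be exchanged. *)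
Definition small_gap A P (e : R) := forall P1 P2 b, charge P1 -> charge P2 ->
  agree_on phi A P1 P -> agree_on phi A P2 P -> P1 (inst b) - P2 (inst b) < e.

(* The average of two extensions of [P] differing by [e] at an instance puts
   that instance at distance [e / 2] from every formula over [A]. *)
Lemma far_instance A P e : ~ small_gap A P e ->
  exists Q b, [/\ charge Q, agree_on phi A Q P &
    forall D, phi_definable phi A D -> e / 2 <= Q (symd D (inst b))].
Proof.
move=> ng; apply: contrapT => nQ; apply: ng => P1 P2 b hP1 hP2 P1A P2A.
rewrite ltNge; apply/negP => le; apply: nQ.
exists (fun D => (P1 D + P2 D) / 2), b; split.
- have [h0 h1 hD] := hP1; have [k0 k1 kD] := hP2; split.
  + by move=> D _; rewrite divr_ge0 // addr_ge0 // ?h0 ?k0.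
  + by rewrite h1 k1 -mulr2n -mulr_natr mul1r divff // pnatr_eq0.
  + by move=> D E _ _ DE; rewrite hD // kD //; lra.
- by move=> D AD; rewrite P1A // P2A //; lra.
- move=> D AD.
  have h (Q : _ -> R) : charge Q -> `|Q (inst b) - Q D| <= Q (symd D (inst b)).
    move=> hQ; apply: (charge_on_dist (@set_algebraT _) hQ) => // x xx; by [left|right].
  have := h P1 hP1; have := h P2 hP2; rewrite (P1A D) // (P2A D) // !ler_norml.
  by move=> /andP[? ?] /andP[? ?]; lra.
Qed.

(** Iterates [far_instance]: each new instance is far from every formula over the parameters
    collected so far, in particular from the earlier instances. *)
Lemma far_instances A P e :
  (forall C Q, countable C -> charge Q -> agree_on phi A Q P ->
     ~ small_gap (A `|` C) Q e) -> charge P ->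
  forall N, exists C Q (b : nat -> 'I_n -> U),
    [/\ countable C, charge Q, agree_on phi A Q P,
        forall i, (i < N)%N -> tuples (A `|` C) n (b i) &
        forall i j, (i < j < N)%N -> e / 2 <= Q (symd (inst (b i)) (inst (b j)))].
Proof.
move=> gap hP; elim=> [|N [C [Q [b [cC hQ QA bAC bfar]]]]].
  case: (carrier_inhabited U) => u; exists set0, P, (fun _ _ => u); split=> //.
  by move=> i j; rewrite ltn0 andbF.
have [Q' [c [hQ' Q'A cfar]]] := far_instance (gap C Q cC hQ QA).
exists (C `|` range c), Q', (fun i => if (i < N)%N then b i else c); split=> //.
- rewrite -bigcup2E; apply: bigcup_countable => // -[|[|i]] _ //=.
  exact: (card_le_trans (card_image_le _ _) (countableP _)).
- by move=> D AD; rewrite Q'A ?QA //; apply: phi_definable_sub AD => x; left.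
- move=> i _ k; case: ifP => [iN|_]; last by right; right; exists k.
  by case: (bAC i iN k) => ?; [left|right; left].
- move=> i j /andP[ij]; rewrite ltnS leq_eqVlt => /predU1P[jN|jN].
    by rewrite jN ltnn -jN ij; apply: cfar; apply: phi_definable_inst;
      apply: bAC; rewrite -jN.
  (* [Q'] agrees with [Q] over [A] and [C], which contain the earlier parameters, so the earlier
     distances are unchanged. *)
  have iN := ltn_trans ij jN; rewrite iN jN Q'A; first by apply: bfar; rewrite ij.
  have hb k : (k < N)%N -> phi_definable phi (A `|` C) (inst (b k)).
    by move=> /bAC; exact: phi_definable_inst.
  by apply: set_algebraU; [exact: phi_algebra|apply: set_algebraD..];
    try exact: phi_algebra; exact: hb.
Qed.

(** Otherwise [far_instances] would produce more pairwise distant instances than [NIP_packing]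
    allows. *)
Lemma small_gap_extension A P e : NIP U phi -> charge P -> 0 < e ->
  exists C Q, [/\ countable C, charge Q, agree_on phi A Q P &
    small_gap (A `|` C) Q e].
Proof.
move=> nip hP e0; apply: contrapT => nCQ.
have e2 : 0 < e / 2 by rewrite divr_gt0.
have [N NP] := NIP_packing hK satU nip e2.
have [C Q cC hQ QA sg|C [Q [b [cC hQ _ _ bfar]]]] := far_instances (A := A) (e := e) _ hP N.
  by apply: nCQ; exists C, Q.
apply: (NP Q (fun i => b i) hQ) => i j ij; apply: bfar.
by rewrite ij /=.
Qed.

Lemma NIP_smooth_extension (M : set U) (mu : phi_measure R phi M) :
  NIP U phi -> small K M ->
  exists nu : phi_measure R phi setT, agree_on phi M nu mu /\ smooth K nu.
Proof.
move=> nip smM.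
have [P0 [hP0 P0mu _]] :=
  charge_on_extension set0 (phi_algebra phi M) (phi_measure_charge mu).
(* The hypotheses are placed inside the existential statement so that [next] is total; the pair
   [(C, P)] itself is the default value. *)
have /choice[next nextP] (p : nat * (set U * (set ('I_m -> U) -> R))) :
    exists q : set U * (set ('I_m -> U) -> R),
    countable p.2.1 -> charge p.2.2 ->
    [/\ countable q.1, charge q.2, p.2.1 `<=` q.1,
        agree_on phi (M `|` p.2.1) q.2 p.2.2 &
        small_gap (M `|` q.1) q.2 p.1.+1%:R^-1].
  case: p => k [C P] /=; case: (lem (countable C /\ charge P)); last first.
    by move=> nCP; exists (C, P) => cC hP; case: nCP.
  move=> [cC hP].
  have k0 : 0 < k.+1%:R^-1 :> R by rewrite invr_gt0 ltr0n.
  have [C' [Q [cC' hQ QA sg]]] := small_gap_extension (M `|` C) nip hP k0.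
  exists (C `|` C', Q) => _ _; split=> //=.
  - by rewrite -bigcup2E; apply: bigcup_countable => // -[|[|i]] _ /=.
  - by rewrite setUA.
pose st := fix st k := if k is k'.+1 then next (k', st k') else (set0, P0).
have st_ok k : countable (st k).1 /\ charge (st k).2.
  by elim: k => [|k [cC hP]] //=; have [] := nextP (k, st k) cC hP.
have stP k := nextP (k, st k) (st_ok k).1 (st_ok k).2.
pose A k := M `|` (st k).1.
have Ale i j : (i <= j)%N -> A i `<=` A j.
  elim: j => [|j IH]; first by rewrite leqn0 => /eqP ->.
  rewrite leq_eqVlt => /predU1P[->//|]; rewrite ltnS => /IH ij x /ij [Mx|Cx].
    by left.
  by right; case: (stP j) => _ _ + _ _; apply.
have agree i j : (i <= j)%N -> agree_on phi (A i) (st j).2 (st i).2.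
  elim: j => [|j IH]; first by rewrite leqn0 => /eqP -> D.
  rewrite leq_eqVlt => /predU1P[->//|]; rewrite ltnS => ij D AD.
  rewrite -(IH ij D AD); case: (stP j) => _ _ _ + _; apply.
  exact: phi_definable_sub (Ale _ _ ij) _ AD.
(* On formulas over [A k] the measures are constant from stage [k] on, so the limit extends every
   stage. *)
have [Q hQ Qle] := charge_ultralimit (FF := \oo) _ (fun k => (st_ok k).2).
have QA k : agree_on phi (A k) Q (st k).2.
  move=> D AD; apply/esym/eqP; rewrite eq_le; apply: Qle.
  by exists k => // j /= kj; rewrite (agree k j kj D AD) lexx.
exists (charge_phi_measure phi setT hQ); split.
  move=> D MD /=; rewrite (QA 0%N) /=; first exact: P0mu.
  by apply: phi_definable_sub MD => x; left.
exists (\bigcup_k A k).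
  rewrite (_ : \bigcup_k A k = M `|` \bigcup_k (st k).1).
    by apply: (small_setU_countable hK) => //; apply: bigcup_countable => // k _;
      case: (st_ok k).
  apply/seteqP; split=> x.
    by move=> [k _ [Mx|Cx]]; [left|right; exists k].
  by move=> [Mx|[k _ Cx]]; [exists 0%N => //; left|exists k => //; right].
apply: smooth_overP => nu' b nu'A.
(* [nu'] is extended to all subsets because [small_gap] compares charges. *)
have [P [hP Pnu' _]] :=
  charge_on_extension set0 (phi_algebra phi setT) (phi_measure_charge nu').
have Tb : phi_definable phi setT (inst b) by exact: phi_definable_inst.
rewrite -Pnu' //; suff -> : P (inst b) = Q (inst b) by [].
apply/eqP; rewrite -subr_eq0 -normr_eq0 eq_le normr_ge0 andbT.
apply/ler_addgt0Pl => e e0; rewrite addr0.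
have [k ke] : exists k : nat, k.+1%:R^-1 < e.
  by have [k] := ltr_add_invr e0; rewrite add0r; exists k.
have PAk : agree_on phi (A k.+1) P (st k.+1).2.
  move=> D AD; rewrite Pnu'; last exact: phi_definable_sub (@subsetT _ _) _ AD.
  rewrite nu'A; first exact: (QA k.+1 D AD).
  by apply: phi_definable_sub AD => x Ax; exists k.+1.
(* Both [P] and [Q] extend stage [k.+1], whose gap is below [k.+1%:R^-1]. *)
case: (stP k) => _ _ _ _ sg.
have h1 : P (inst b) - Q (inst b) < k.+1%:R^-1 by exact: sg hP hQ PAk (QA k.+1).
have h2 : Q (inst b) - P (inst b) < k.+1%:R^-1 by exact: sg hQ hP (QA k.+1) PAk.
by rewrite ler_norml lerNl opprB !ltW ?(lt_trans h1) ?(lt_trans h2).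
Qed.

End SmoothExtension.

(** * Strong definability of smooth measures *)

Section SmoothDefinable.
Context (R : realType) (K : Type) (L : language) (U : structure L).
Hypothesis hK : card_lt [set: all_formulas L] [set: K].
Hypothesis satU : saturated K U.
Context (m n : nat) (phi : formula L (m + n)).
Notation inst b := (fun a => holds (U := U) phi a b).
Implicit Types (A : set U).

Lemma definable_over_sandwich A E F :
  phi_definable phi A E -> phi_definable phi A F ->
  definable_over A [set b | ~ (E `<=` inst b /\ inst b `<=` F)].
Proof.
move=> [cE _ <-] [cF _ <-].
(* The variables stand for [b], for the parameters, and for the point [a] to be quantified. *)
pose W : Type := ('I_n + A) + 'I_m.
pose S (c : phi_formula A n) := [set w : W -> U | beval (fun t : tuples A n =>
  holds phi (fun j => w (inr j)) (fun j => w (inl (inr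
    (exist (fun x => x \in A) (val t j) (mem_set (set_mem (valP t) j))))))) c].
have dS c : definable (S c).
  by apply: definable_beval => t; exact: definable_holds.
have dI : definable [set w : W -> U |
    holds phi (fun j => w (inr j)) (fun j => w (inl (inl j)))].
  exact: definable_holds.
have := definable_not (definable_forall_sum
  (definable_and (definable_imp (dS cE) dI) (definable_imp dI (dS cF)))).
move=> dB; eexists; split; first exact: dB.
move=> b; split=> nsand sand; apply: nsand.
  by split=> a; have [] := sand a.
by move=> a; split; [exact: sand.1|exact: sand.2].
Qed.

(** Compactness: if finitely many pairs never sufficed, saturation would give a [b] that escapes all
    admissible pairs at once. *)
Lemma finite_sandwich A (nu : set ('I_m -> U) -> R) (e : R) : small K A ->
  (forall b, exists E F, [/\ phi_definable phi A E, phi_definable phi A F,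
     E `<=` inst b, inst b `<=` F & nu (F `\` E) < e]) ->
  exists l : seq (set ('I_m -> U) * set ('I_m -> U)),
    (forall p, p \in l -> [/\ phi_definable phi A p.1, phi_definable phi A p.2 &
       nu (p.2 `\` p.1) < e]) /\
    forall b, exists2 p, p \in l & p.1 `<=` inst b /\ inst b `<=` p.2.
Proof.
move=> smA sand; apply: contrapT => nl.
pose I : set (set ('I_m -> U) * set ('I_m -> U)) := [set p |
  [/\ phi_definable phi A p.1, phi_definable phi A p.2 & nu (p.2 `\` p.1) < e]].
pose D (p : I) := [set b | ~ ((val p).1 `<=` inst b /\ inst b `<=` (val p).2)].
have [p|s /finite_seqP[l ->]|b bD] := saturated_definable (D := D) satU smA.
- by case: (set_mem (valP p)) => ? ? _; exact: definable_over_sandwich.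
- apply: contrapT => nc; apply: nl; exists [seq val p | p <- l]; split.
    by move=> _ /mapP[p _ ->]; exact: (set_mem (valP p)).
  move=> b; apply: contrapT => nb; apply: nc; exists b => p pl sandb.
  by apply: nb; exists (val p) => //; exact: map_f.
- have [E [F [AE AF Eb bF lt]]] := sand b.
  have IEF : (E, F) \in I by apply/mem_set.
  by apply: (bD (exist _ (E, F) IEF)).
Qed.

(* The finitely many sandwiching pairs are measured exactly by a finitely
   supported measure. *)
Lemma finitely_supported_approx A (nu : set ('I_m -> U) -> R) (e : R) : small K A ->
  charge_on (phi_definable phi A) nu ->
  (forall P, charge P -> agree_on phi A P nu ->
     forall b, P (inst b) = nu (inst b)) ->
  charge_on (phi_definable phi setT) nu -> 0 < e ->
  exists s : seq (R * ('I_m -> U)), forall b c,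
    `|nu (symd (inst b) (inst c)) - wsum s (symd (inst b) (inst c))| <= e.
Proof.
(* Each of the two instances is known up to [e / 4], and the error occurs once for [nu] and once for
   the weighted sum. *)
move=> smA nuA uniqi nuT e0; have e4 : 0 < e / 4 by rewrite divr_gt0.
have hA := phi_algebra phi A; have hT := phi_algebra phi [set: U].
have [b|l [lA lb]] := finite_sandwich (nu := nu) (e := e / 4) smA.
  apply: charge_on_sandwich hA nuA _ e4 => P Q hP hQ PA QA.
  by rewrite (uniqi P) // (uniqi Q).
have AsymD D E : phi_definable phi A D -> phi_definable phi A E ->
    phi_definable phi A (symd D E).
  by move=> AD AE; apply: set_algebraU => //; exact: set_algebraD.
pose l' := [seq p.2 `\` p.1 | p <- l] ++ [seq symd p.1 q.1 | p <- l, q <- l].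
have [D|s [s0 s1 sl _]] := charge_on_finite_approxT (l := l') set0 hA nuA.
  rewrite mem_cat => /orP[/mapP[p pl ->]|/allpairsP[[p q] [pl ql ->]]].
    by have [? ? _] := lA p pl; exact: set_algebraD.
  by apply: AsymD; [have [] := lA _ pl|have [] := lA _ ql].
have hs := charge_wsum s0 s1; exists s => b c.
have [p pl [p1b bp2]] := lb b; have [q ql [q1c cq2]] := lb c.
have [Ap1 Ap2 pe] := lA p pl; have [Aq1 Aq2 qe] := lA q ql.
set F := (p.2 `\` p.1) `|` (q.2 `\` q.1); set S := symd p.1 q.1.
have Ap := set_algebraD hA Ap2 Ap1; have Aq := set_algebraD hA Aq2 Aq1.
have sub := phi_definable_sub (phi := phi) (@subsetT _ A).
have SF1 : symd (inst b) (inst c) `\` S `<=` F.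
  move=> x [[[bx nc]|[cx nb]] nS]; apply: contrapT => nF.
    case: nS; left; split; last by move=> /q1c.
    by apply: contrapT => np; apply: nF; left; split=> //; exact: bp2.
  case: nS; right; split; last by move=> /p1b.
  by apply: contrapT => nq; apply: nF; right; split=> //; exact: cq2.
have SF2 : S `\` symd (inst b) (inst c) `<=` F.
  move=> x [[[px nq]|[qx np]] nS]; apply: contrapT => nF; case: nS.
    left; split; first exact: p1b.
    by move=> cx; apply: nF; right; split=> //; exact: cq2.
  right; split; first exact: q1c.
  by move=> bx; apply: nF; left; split=> //; exact: bp2.
have Tb x : phi_definable phi setT (inst x) by exact: phi_definable_inst.
have TS : phi_definable phi setT (symd (inst b) (inst c)).
  exact: (set_algebraU hT (set_algebraD hT (Tb b) (Tb c))
    (set_algebraD hT (Tb c) (Tb b))).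
have := charge_on_dist hT nuT TS (sub _ (AsymD _ _ Ap1 Aq1))
  (sub _ (set_algebraU hA Ap Aq)) SF1 SF2.
have := charge_on_dist (@set_algebraT _) hs I I I SF1 SF2.
have := charge_onU_le hA nuA Ap Aq.
have := charge_onU_le (@set_algebraT _) hs (D := p.2 `\` p.1) (E := q.2 `\` q.1) I I.
have -> : wsum s (p.2 `\` p.1) = nu (p.2 `\` p.1).
  by apply: sl; rewrite mem_cat (map_f (fun p => p.2 `\` p.1)).
have -> : wsum s (q.2 `\` q.1) = nu (q.2 `\` q.1).
  by apply: sl; rewrite mem_cat (map_f (fun p => p.2 `\` p.1)).
have -> : wsum s S = nu S.
  by apply: sl; rewrite mem_cat; apply/orP; right; apply/allpairsP; exists (p, q).
rewrite -/F !ler_norml => ? ? /andP[? ?] /andP[? ?]; apply/andP; split; lra.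
Qed.

Lemma gholds_triangle (b : 'I_2 -> 'I_n -> U) :
  [set a | gholds phi triangle a b] = symd (inst (b ord0)) (inst (b ord_max)).
Proof.
by apply/predeqP => a; split=> [[[? ?]|[? ?]]|[[? ?]|[? ?]]]; [left|right|left|right].
Qed.

End SmoothDefinable.

(** * Continuous functions on the space of dual types *)

Section StoneFunctions.
Context (R : realType) (L : language) (U : structure L).
Context (m n k : nat) (phi : formula L (m + n)) (theta : bcomb 'I_k) (A : set U).
Notation stone := (stone phi theta A).

(* [f p] is the common limit of [g] along the formulas of [p]. *)
Lemma stone_extension (g : ('I_k -> 'I_n -> U) -> R) :
  (forall (p : stone) e, 0 < e -> exists2 chi, stone_set p chi &
     forall b c, dual_holds phi theta b chi -> dual_holds phi theta c chi ->
       `|g b - g c| <= e) ->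
  exists f : stone -> R, continuous f /\ forall b, g b = f (dual_tp phi theta A b).
Proof.
move=> osc.
pose det (chi : dual_formula m A) (e : R) := forall b c : 'I_k -> 'I_n -> U,
  dual_holds phi theta b chi -> dual_holds phi theta c chi -> `|g b - g c| <= e.
have real2 (p : stone) chi xi : stone_set p chi -> stone_set p xi ->
    exists b, dual_holds phi theta b chi /\ dual_holds phi theta b xi.
  move=> pc px; have [||b bP] := @stone_fin_sat _ _ _ _ _ _ _ _ p [set chi; xi].
  - by rewrite finite_setU; split; exact: finite_set1.
  - by move=> _ [->|->].
  by exists b; split; apply: bP; [left|right].
have /choice[f fP] (p : stone) : exists r, forall chi e b, stone_set p chi ->
    det chi e -> dual_holds phi theta b chi -> `|r - g b| <= e.
  (* The value at [p] is the supremum of the lower bounds [g b - e]. Any two formulas of [p] are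
     realized together, so each [g b + e] bounds them from above. *)
  pose S := [set x | exists chi e b, [/\ stone_set p chi, det chi e,
    dual_holds phi theta b chi & x = g b - e]].
  have ubS chi e b : stone_set p chi -> det chi e -> dual_holds phi theta b chi ->
      ubound S (g b + e).
    move=> pc dc bc _ [xi [e' [c [px dx cx ->]]]].
    have [d [dc' dx']] := real2 p _ _ pc px.
    have := dc b d bc dc'; have := dx c d cx dx'; rewrite !ler_norml.
    by move=> /andP[? ?] /andP[? ?]; lra.
  have [chi0 pc0 dc0] := osc p 1 ltr01.
  have [b0 [bc0 _]] := real2 p _ _ pc0 pc0.
  have S0 : S !=set0 by exists (g b0 - 1), chi0, 1, b0.
  exists (sup S) => chi e b pc dc bc.
  have h1 : sup S <= g b + e by apply: ge_sup => //; exact: ubS pc dc bc.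
  have h2 : g b - e <= sup S.
    apply: ub_le_sup; first by exists (g b0 + 1); exact: ubS pc0 dc0 bc0.
    by exists chi, e, b.
  by rewrite ler_norml; apply/andP; split; lra.
exists f; split=> [p|b]; last first.
  apply/eqP; rewrite -subr_eq0 -normr_eq0 eq_le normr_ge0 andbT.
  apply/ler_addgt0Pl => e e0; rewrite addr0 distrC.
  have [chi pc dc] := osc (dual_tp phi theta A b) e e0.
  exact: (fP _ _ _ b pc dc pc).
apply/(cvgrPdist_le (FF := nbhs_filter p)) => e e0; have e2 : 0 < e / 2 by rewrite divr_gt0.
have [chi pc dc] := osc p _ e2.
exists (stone_basic chi); first split => //.
  by move=> q qc; exists chi.
move=> q /= qc; have [b [bc _]] := real2 p _ _ pc pc.
have := fP p _ _ b pc dc bc; have := fP q _ _ b qc dc bc.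
by rewrite !ler_norml => /andP[? ?] /andP[? ?]; apply/andP; split; lra.
Qed.

Lemma stone_decides (p : stone) (s : seq ('I_m -> U)) :
  all (fun a => `[< tuples A m a >]) s ->
  exists2 chi, stone_set p chi &
    forall b c, dual_holds phi theta b chi -> dual_holds phi theta c chi ->
      all (fun a => `[< gholds phi theta a b >] == `[< gholds phi theta a c >]) s.
Proof.
elim: s => [_|a s IH /= /andP[/asboolP Aa /IH[chi pc chiP]]].
  by exists (BTrue _) => //; exact: stone_true.
pose xi := BAtom (exist (fun t => t \in tuples A m) a (mem_set Aa)).
case: (stone_complete p xi) => px.
  exists (BAnd xi chi); first exact/stone_and.
  move=> b c [/= bx bc] [/= cx cc]; rewrite chiP // andbT.
  by apply/eqP; rewrite !asboolT.
exists (BAnd (BNot xi) chi); first exact/stone_and.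
move=> b c [/= bx bc] [/= cx cc]; rewrite chiP // andbT.
by apply/eqP; rewrite !asboolF.
Qed.

End StoneFunctions.

Section SmoothStronglyDefinable.
Context (R : realType) (K : Type) (L : language) (U : structure L).
Hypothesis hK : card_lt [set: all_formulas L] [set: K].
Hypothesis satU : saturated K U.
Context (m n : nat) (phi : formula L (m + n)).
Notation inst b := (fun a => holds (U := U) phi a b).

Lemma smooth_strongly_definable (nu : phi_measure R phi [set: U]) :
  smooth K nu -> strongly_definable K triangle nu.
Proof.
move=> [A smA nu_smooth].
have nuT := phi_measure_charge nu; have nuA := phi_measure_restrict A nu.
have uniqi P : charge P -> agree_on phi A P nu ->
    forall b, P (inst b) = nu (inst b).
  move=> hP PA b; apply: (nu_smooth (charge_phi_measure phi setT hP) PA).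
  exact: phi_definable_inst.
have /choice[s sP] (j : nat) := finitely_supported_approx (e := j.+1%:R^-1) satU
  smA nuA uniqi nuT (etrans (invr_gt0 _) (ltr0Sn R j)).
(* The coordinates of all support points form a countable set, and definability is shown over this
   set instead of [A]. *)
pose A' : set U := \bigcup_j \bigcup_(a in [set a | List.In a [seq p.2 | p <- s j]])
  range a.
have A'P j : all (fun a => `[< tuples A' m a >]) [seq p.2 | p <- s j].
  suff h t : (forall a, List.In a t -> tuples A' m a) ->
      all (fun a => `[< tuples A' m a >]) t.
    by apply: h => a aj i; exists j => //; exists a => //; exists i.
  elim: t => //= a t IH h; rewrite IH ?andbT; last by move=> b bt; apply: h; right.
  by apply/asboolP; apply: h; left.
exists A'.
  apply: (small_countable hK); apply: bigcup_countable => [|j _]; first exact: countableP.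
  apply: bigcup_countable => [|a _]; last first.
    exact: (card_le_trans (card_image_le _ _) (countableP _)).
  apply: finite_set_countable; elim: [seq p.2 | p <- s j] => [|a t IH] /=.
    by rewrite (_ : [set _ | _] = set0) //; apply/seteqP; split.
  rewrite (_ : [set _ | _] = a |` [set b | List.In b t]).
    by rewrite finite_setU; split=> //; exact: finite_set1.
  by apply/seteqP; split=> b [->|]; [left|right|left|right].
apply: stone_extension => p e e0.
have [j je] : exists j : nat, j.+1%:R^-1 < e / 2.
  have e2 : 0 < e / 2 by rewrite divr_gt0.
  by have [j] := ltr_add_invr e2; rewrite add0r; exists j.
have [chi pc chiP] := stone_decides p (A'P j); exists chi => // b c bc cc.
have := chiP b c bc cc; rewrite all_map !gholds_triangle => h.
have ws : wsum (s j) (symd (inst (b ord0)) (inst (b ord_max))) =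
    wsum (s j) (symd (inst (c ord0)) (inst (c ord_max))).
  rewrite -!gholds_triangle /wsum; elim: (s j) h => [|q t IH] /=.
    by rewrite !big_nil.
  move=> /andP[/eqP qE /IH IHt]; rewrite !big_cons IHt.
  by congr (_ * _%:R + _); exact: congr1 qE.
have /(_ (b ord0) (b ord_max)) := sP j; have /(_ (c ord0) (c ord_max)) := sP j.
move: je; rewrite ws; move: (j.+1%:R^-1) => r re.
by rewrite !ler_norml => /andP[? ?] /andP[? ?]; apply/andP; split; lra.
Qed.

End SmoothStronglyDefinable.

(** * Packing numbers *)

Section SkolemHull.
Context (L : language).

(** [SkApp psi ts] names a counterexample to [FAll psi] at the values of [ts], if there is one;
    constants name the points that the hull has to contain. *)
Inductive skolem_term :=
| SkConst of nat
| SkApp (k : nat) (psi : formula L k.+1) of ('I_k -> skolem_term).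

(** Such partial inverses of the constructors give injectivity by congruence, avoiding the equations
    between dependent pairs that inversion on [formula] creates. *)
Definition fimp_l n (psi : formula L n) : formula L n :=
  match psi with FImp _ p _ => p | p => p end.

Definition fimp_r n (psi : formula L n) : formula L n :=
  match psi with FImp _ _ q => q | q => q end.

Definition fall_body n (psi : formula L n) : formula L n.+1 :=
  match psi with FAll _ p => p | FBot k => FBot L k.+1 | FEq k _ _ => FBot L k.+1
  | FRel k _ _ => FBot L k.+1 | FImp k _ _ => FBot L k.+1 end.

Fixpoint fdepth n (psi : formula L n) : nat :=
  match psi with FImp _ _ q => (fdepth q).+1 | _ => 0%N end.

Fixpoint fnum (i : nat) : formula L 0 :=
  if i is i'.+1 then FImp (FBot L 0) (fnum i') else FBot L 0.

Fixpoint fclose (n : nat) : formula L n -> formula L 0 :=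
  match n with 0 => id | n'.+1 => fun psi => fclose (FAll psi) end.

Fixpoint ftuple (n : nat) : ('I_n -> formula L 0) -> formula L 0 :=
  match n with
  | 0 => fun=> FBot L 0
  | n'.+1 => fun g => FImp (g ord0) (ftuple (fun i => g (lift ord0 i)))
  end.

Lemma fnum_inj : injective fnum.
Proof. by apply: (can_inj (g := @fdepth 0)); elim=> //= i ->. Qed.

Lemma fclose_inj n : injective (@fclose n).
Proof.
elim: n => [|n IH] p q //= /IH/(congr1 (@fall_body n)) //.
Qed.

Lemma ftuple_inj n : injective (@ftuple n).
Proof.
elim: n => [|n IH] g h /= e; first by apply/funext => -[].
apply/funext => i; case: (unliftP ord0 i) => [j|] ->.
  exact: (congr1 (fun g => g j) (IH _ _ (congr1 (@fimp_r 0) e))).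
exact: (congr1 (@fimp_l 0) e).
Qed.

(* Skolem terms inject into sentences, so that there are at most as many of
   them as formulas. *)
Fixpoint skolem_code (t : skolem_term) : formula L 0 :=
  match t with
  | SkConst i => FImp (FBot L 0) (fnum i)
  | SkApp k psi ts => FImp (FImp (FBot L 0) (fnum k))
      (FImp (fclose psi) (ftuple (fun i => skolem_code (ts i))))
  end.

Lemma skolem_code_inj : injective skolem_code.
Proof.
elim=> [i|k psi ts IH] [j|l xi us] /= e.
- by congr SkConst; apply: fnum_inj; exact: (congr1 (@fimp_r 0) e).
(* The left component has depth 0 for a constant and positive depth for an application. *)
- by have := congr1 (fun p => fdepth (fimp_l p)) e.
- by have := congr1 (fun p => fdepth (fimp_l p)) e.
have kl : k = l by apply: fnum_inj; exact: (congr1 (fun p => fimp_r (fimp_l p)) e).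
move: xi us e; rewrite -kl => xi us e.
have -> : psi = xi.
  by apply: fclose_inj; exact: (congr1 (fun p => fimp_l (fimp_r p)) e).
congr SkApp; apply/funext => i; apply: IH.
have := ftuple_inj (congr1 (fun p => fimp_r (fimp_r p)) e).
by move/(congr1 (fun g => g i)).
Qed.

Context (U : structure L) (c : nat -> U).

Definition skolem_witness k (psi : formula L k.+1) (v : 'I_k -> U) : U :=
  if pselect (exists d, ~ sat psi (scons d v)) is left e then projT1 (cid e)
  else inhabited_witness (carrier_inhabited U).

Lemma skolem_witnessP k (psi : formula L k.+1) (v : 'I_k -> U) :
  (exists d, ~ sat psi (scons d v)) -> ~ sat psi (scons (skolem_witness psi v) v).
Proof. by rewrite /skolem_witness; case: pselect => // e _; case: (cid e). Qed.

Fixpoint skolem_eval (t : skolem_term) : U :=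
  match t with
  | SkConst i => c i
  | SkApp k psi ts => skolem_witness psi (fun i => skolem_eval (ts i))
  end.

Definition skolem_hull : set U := range skolem_eval.

Lemma card_skolem_hull : skolem_hull #<= [set: all_formulas L].
Proof.
apply: card_le_trans (card_image_le _ _) _.
apply: (embedding_card_le (f := fun t => existT _ 0%N (skolem_code t))) => // s t _ _ e.
(* [fclose] is the identity on sentences and is defined at every arity, so it recovers the sentence
   from the dependent pair. *)
by apply: skolem_code_inj; exact: (congr1 (fun p => fclose (projT2 p)) e).
Qed.

Lemma skolem_hull_const i : skolem_hull (c i).
Proof. by exists (SkConst i). Qed.

Lemma skolem_hull_witness k (psi : formula L k.+1) (v : 'I_k -> U) :
  tuples skolem_hull k v -> skolem_hull (skolem_witness psi v).
Proof.
move=> vM; have /choice[ts tsv] (i : 'I_k) : exists t, skolem_eval t = v i.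
  by have [t _ <-] := vM i; exists t.
by exists (SkApp psi ts) => //=; congr skolem_witness; apply/funext.
Qed.

Lemma skolem_hull_substructure : is_substructure skolem_hull.
Proof.
split; first by exists (c 0%N); exact: skolem_hull_const.
move=> f v vM.
(* The value of [f] at [v] is the only counterexample to this formula, so the Skolem witness must be
   that value. *)
pose psi := FNot (FEq (Var L ord0) (App (fun i => Var L (lift ord0 i)))) : formula L (fun_ar f).+1.
have psiE d : ~ sat psi (scons d v) <-> d = interp_fun v.
  rewrite /= scons0; have -> : (fun i => scons d v (lift ord0 i)) = v.
    by apply/funext => i; rewrite sconsS.
  by split=> [/contrapT|-> h]; last exact: h.
have /psiE <- := skolem_witnessP (ex_intro _ (interp_fun v) ((psiE (interp_fun v)).2 erefl)).
exact: skolem_hull_witness.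
Qed.

Let HM := skolem_hull_substructure.

(** The Tarski-Vaught criterion: a universal formula that fails in [U] already fails at its Skolem
    witness, which lies in the hull. *)
Lemma sat_skolem_hull n (psi : formula L n) (v : 'I_n -> substructure HM) :
  sat psi v <-> @sat L U n psi (fun i => val (v i)).
Proof.
have teval_hull k (w : 'I_k -> substructure HM) t :
    val (teval w t) = @teval L U k (fun i => val (w i)) t.
  by elim: t => //= f ts IH; congr interp_fun; apply/funext.
elim: psi v => {n} [n|n s t|n r ts|n p IHp q IHq|n p IH] v //=.
- by rewrite -!teval_hull; split=> [->//|/val_inj].
- by have -> : (fun i => val (teval v (ts i))) =
     (fun i => @teval L U n (fun i => val (v i)) (ts i)) by
    apply/funext => i; rewrite teval_hull.
- by split=> H /IHp/H/IHq.
have vals d : (fun i => val (@scons (substructure HM) n d v i)) =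
    scons (val d) (fun i => val (v i)).
  by apply/funext => i; rewrite /scons; case: unlift.
split=> H d; last by apply/IH; rewrite vals.
apply: contrapT => nd.
have := skolem_witnessP (ex_intro (fun d => ~ sat p (scons d _)) d nd); apply.
have Mw : skolem_witness p (fun i => val (v i)) \in skolem_hull.
  by apply/mem_set/skolem_hull_witness => i; apply: set_mem; exact: valP.
by have /IH := H (exist (fun x => x \in skolem_hull) _ Mw); rewrite vals.
Qed.

Lemma downward_Lowenheim_Skolem (T : set (sentence L)) : models U T ->
  exists M : set U, [/\ elementary_submodel T M, M #<= [set: all_formulas L] &
    forall i, M (c i)].
Proof.
move=> UT; exists skolem_hull; split.
- exists HM; split=> [s Ts v|n psi v]; last exact: sat_skolem_hull.
  by apply/sat_skolem_hull; exact: UT.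
- exact: card_skolem_hull.
- exact: skolem_hull_const.
Qed.

End SkolemHull.

(** * Finite packing numbers: from strong definability, and towards NIP *)

Section Packing.
Context (R : realType) (L : language) (U : structure L).
Context (m n : nat) (phi : formula L (m + n)).
Notation inst b := (fun a => holds (U := U) phi a b).

Lemma packing_number_lty (A : set U) (mu : phi_measure R phi A) eps N :
  (forall l, packing mu eps l -> (l <= N)%N) -> (packing_number mu eps < +oo)%E.
Proof.
move=> packN; apply: (@le_lt_trans _ _ (N%:R%:E)); last exact: ltry.
by apply: ge_ereal_sup => _ [l /packN lN <-]; rewrite lee_fin ler_nat.
Qed.

Lemma packing_number_eqy (A : set U) (mu : phi_measure R phi A) eps :
  (forall l, packing mu eps l) -> packing_number mu eps = +oo%E.
Proof.
move=> packl; apply/eqyP => r r0.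
apply: (@le_trans _ _ (Num.bound r)%:R%:E).
  by rewrite lee_fin ltW // archi_boundP // ltW.
by apply: ereal_sup_ubound; exists (Num.bound r).
Qed.

(* A formula [chi] over [A] sees only finitely many bits of [b]; if [b] and [c]
   agree on them, then [chi] cannot tell the pair [(b, c)] from a diagonal one. *)
Lemma dual_formula_coloring (A : set U) (chi : dual_formula m A) (d : 'I_n -> U) :
  exists (C : finType) (h : ('I_n -> U) -> C), forall b c, h b = h c ->
    dual_holds phi triangle (pair2 b c) chi <-> dual_holds phi triangle (pair2 d d) chi.
Proof.
have diag a b : ~ gholds phi triangle a (pair2 b b).
  by rewrite /gholds /pair2 /= => -[[]|[]].
elim: chi => [|a|chi [C [h hP]]|chi [C [h hP]] xi [D [k kP]]|chi [C [h hP]] xi [D [k kP]]].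
- by exists unit, (fun=> tt).
- exists bool, (fun b => `[< holds phi (val a) b >]) => b c bc.
  split=> [|/diag//]; rewrite /dual_holds /gholds /pair2 /= => -[[hb nc]|[nb hc]].
    by case: nc; apply/asboolP; rewrite -bc; apply/asboolP.
  by case: nb; apply/asboolP; rewrite bc; apply/asboolP.
- by exists C, h => b c /hP bc; split=> /= H /bc.
- exists (C * D)%type, (fun b => (h b, k b)) => b c [/hP hbc /kP kbc] /=.
  by split=> -[/hbc ? /kbc ?].
- exists (C * D)%type, (fun b => (h b, k b)) => b c [/hP hbc /kP kbc] /=.
  by split=> -[/hbc ?|/kbc ?]; [left|right|left|right].
Qed.

(** Continuity gives a formula [chi] in the type of a diagonal pair on which the measure stays below
    [eps]. With more points than colors for [chi], two share a color and form a pair satisfying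
    [chi]. *)
Lemma strongly_definable_packing (A : set U) (nu : phi_measure R phi setT) (eps : R) :
  strongly_definable_over triangle nu A -> 0 < eps ->
  exists N, forall b : 'I_N.+1 -> 'I_n -> U, exists i j : 'I_N.+1, (i < j)%N /\
    nu [set a | gholds phi triangle a (pair2 (b i) (b j))] < eps.
Proof.
move=> [f [fcont fE]] eps0.
pose d : 'I_n -> U := fun=> inhabited_witness (carrier_inhabited U).
pose p := dual_tp phi triangle A (pair2 d d).
have fp : f p = 0.
  rewrite -fE (_ : [set a | _] = set0).
    exact: (charge_on_set0 (phi_algebra phi _) (phi_measure_charge nu)).
  by apply/seteqP; split=> // a; rewrite /gholds /pair2 /= => -[[]|[]].
have /(_ _ eps0) := (cvgrPdist_lt (FF := nbhs_filter p) f (f p)).1 (fcont p).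
rewrite /= nbhsE => -[D [oD Dp] Dlt].
have [chi pchi chiD] := oD p Dp.
have [C [h hP]] := dual_formula_coloring chi d.
exists #|C| => b.
have [i [j [ij hij]]] : exists i j : 'I_(#|C|.+1), (i < j)%N /\ h (b i) = h (b j).
  apply: contrapT => nij.
  have hinj : injective (fun i => h (b i)).
    move=> i j hij; apply: val_inj => /=; case: (ltngtP i j) => // lt; exfalso.
      by apply: nij; exists i, j.
    by apply: nij; exists j, i.
  by have := leq_card _ hinj; rewrite card_ord ltnn.
exists i, j; split=> //; rewrite fE.
have := Dlt (dual_tp phi triangle A (pair2 (b i) (b j))).
rewrite fp /= sub0r normrN => lt; apply: le_lt_trans (ler_norm _) (lt _).
by apply: chiD; apply/(hP _ _ hij).
Qed.

Lemma strongly_definable_packing_lty (K : Type) (T : set (sentence L)) :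
  models U T -> card_lt [set: all_formulas L] [set: K] ->
  (forall M : set U, elementary_submodel T M -> small K M ->
     M #<= [set: all_formulas L] -> forall mu : phi_measure R phi M,
     exists nu : phi_measure R phi [set: U],
       agree_on phi M nu mu /\ strongly_definable K triangle nu) ->
  forall (mu : phi_measure R phi [set: U]) (eps : R), 0 < eps ->
    (packing_number mu eps < +oo)%E.
Proof.
move=> UT hK ext mu eps eps0; apply: contrapT => nlty.
(* Arbitrarily large packings need not come from one infinite packing, so each [N] has its own
   family of points. *)
have /choice[b bP] (N : nat) : exists b : nat -> 'I_n -> U, forall i j,
    (i < j <= N)%N -> eps <= mu [set a | gholds phi triangle a (pair2 (b i) (b j))].
  have [l Nl [b [_ bP]]] : exists2 l, (N < l)%N & packing mu eps l.
    apply: contrapT => nl; apply/nlty/(@packing_number_lty _ _ _ N) => l lpack.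
    by rewrite leqNgt; apply/negP => Nl; apply: nl; exists l.
  case: l Nl b bP => // l; rewrite ltnS => Nl b bP.
  exists (fun i => b (inord i)) => i j /andP[ij jN].
  have jl : (j < l.+1)%N by rewrite ltnS; exact: leq_trans jN Nl.
  by apply: bP; rewrite !inordK // (ltn_trans ij).
(* All coordinates of all families are listed in one sequence, which is then put into [M]. *)
pose c k := if unpickle k is Some (N, i, j) then b N i j
  else inhabited_witness (carrier_inhabited U).
have [M [elM MF Mc]] := downward_Lowenheim_Skolem c UT.
have Mb N i : tuples M n (b N i).
  by move=> j; have := Mc (pickle (N, i, j)); rewrite /c pickleK.
have smM := small_card_le hK MF.
have [P [hP Pmu _]] :=
  charge_on_extension set0 (phi_algebra phi [set: U]) (phi_measure_charge mu).
have [nu [nuP [A _ nuA]]] := ext M elM smM MF (charge_phi_measure phi M hP).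
have [N NP] := strongly_definable_packing nuA eps0.
have [i [j [ij]]] := NP (fun i => b N i); rewrite ltNge => /negP; apply.
have Msymd : phi_definable phi M (symd (inst (b N i)) (inst (b N j))).
  have hM := phi_algebra phi M.
  exact: (set_algebraU hM
    (set_algebraD hM (phi_definable_inst phi (Mb N i)) (phi_definable_inst phi (Mb N j)))
    (set_algebraD hM (phi_definable_inst phi (Mb N j)) (phi_definable_inst phi (Mb N i)))).
have ijN : (i < j <= N)%N by rewrite ij -ltnS ltn_ord.
rewrite gholds_triangle nuP //; apply: le_trans (bP N i j ijN) _.
rewrite gholds_triangle /= Pmu //.
exact: (phi_definable_sub (@subsetT _ M)).
Qed.

(* The sets containing exactly one of [i] and [j] are exchanged with the others
   by the symmetric difference with [{i}]. *)
Lemma sum_separating_sets N (i j : 'I_N) : i != j ->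
  (\sum_(S : {set 'I_N}) ((i \in S) != (j \in S)) * 2 = 2 ^ N)%N.
Proof.
move=> ij; pose h (S : {set 'I_N}) := [set t | (t \in S) (+) (t == i)]%SET.
have hinj : injective h.
  by move=> S S' /finset.setP e; apply/finset.setP => t; have := e t;
    rewrite !inE => /addIb.
rewrite -big_distrl /= mulnS muln1 {2}(reindex_inj hinj) /= -big_split /=.
rewrite (eq_bigr (fun=> 1%N)); last first.
  move=> S _; rewrite !inE eqxx addbT (eq_sym j) (negbTE ij) addbF.
  by case: (i \in S); case: (j \in S).
by rewrite sum1_card -cardsT -powersetT card_powerset cardsT card_ord.
Qed.

Lemma packing_lty_NIP :
  (forall (mu : phi_measure R phi [set: U]) (eps : R), 0 < eps ->
     (packing_number mu eps < +oo)%E) -> NIP U phi.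
Proof.
move=> pack [B [/infiniteP/card_le_embedding[y0 y0inj] shB]].
pose y k : 'I_n -> U := val (y0 (exist _ k (mem_setT k))).
have By k : B (y k) by apply: set_mem; exact: valP.
have yinj : injective y by move=> k l /val_inj/y0inj[].
have /choice[a0 aP0] (p : {N : nat & {set 'I_N}}) : exists a : 'I_m -> U,
    forall i : 'I_(projT1 p), holds phi a (y i) <-> i \in projT2 p.
  case: p => N S /=.
  have fin (Q : set 'I_N) : finite_set [set y i | i in Q].
    by apply: finite_image; exact: finite_finset.
  have sub (Q : set 'I_N) : [set y (nat_of_ord i) | i in Q] `<=` B by move=> _ [i _ <-].
  have [|a [aX aY]] := shB _ _ (fin [set i | i \in S]) (fin [set i | i \notin S])
      (sub _) (sub _).
    by apply/seteqP; split=> // _ [[i /= iS <-] [j /= jS /yinj/ord_inj ji]];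
      move: jS; rewrite ji iS.
  exists a => i; split=> [ai|iS]; last by apply: aX; exists i.
  by apply: contrapT => /negP iS; apply: aY ai; exists i.
pose a N (S : {set 'I_N}) := a0 (existT _ N S).
have aP N (S : {set 'I_N}) (i : 'I_N) : holds phi (a N S) (y i) <-> i \in S.
  exact: (aP0 (existT _ N S) i).
(* Equal weights on realizations of all truth patterns of the first [N] instances model [N] fair
   coin tosses. *)
pose s N := [seq ((2 ^+ N)^-1 : R, a N C) | C <- enum {set 'I_N}].
have sE N E : wsum (s N) E = (2 ^+ N)^-1 * \sum_(S : {set 'I_N}) (`[< E (a N S) >])%:R.
  by rewrite /wsum big_map big_enum /= mulr_sumr.
have hs N : charge (wsum (s N)).
  apply: charge_wsum.
    by rewrite all_map; apply/allP => C _ /=; rewrite invr_ge0 exprn_ge0.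
  rewrite sE (eq_bigr (fun=> 1)) => [|S _]; last by rewrite asboolT.
  rewrite sumr_const -cardsT -powersetT card_powerset cardsT card_ord natrX mulVf.
    by [].
  by rewrite expf_neq0 // pnatr_eq0.
have half N (i j : 'I_N) : i != j -> wsum (s N) (symd (inst (y i)) (inst (y j))) = 2^-1.
  move=> ij; rewrite sE; have := sum_separating_sets ij.
  rewrite -big_distrl /= => /(congr1 (fun k => k%:R : R)); rewrite natrM natrX natr_sum => e.
  have n0 : (2 ^+ N : R) != 0 by rewrite expf_neq0 // pnatr_eq0.
  rewrite (eq_bigr (fun S : {set 'I_N} => ((i \in S) != (j \in S))%:R)); last first.
    move=> S _; congr (_%:R); have := aP N S i; have := aP N S j.
    case: asboolP => [[[hi hj]|[hj hi]]|nsd] ej ei.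
    - by have -> := ei.1 hi; case: (boolP (j \in S)) => // /ej.
    - by have -> := ej.1 hj; case: (boolP (i \in S)) => // /ei.
    - case: (boolP (i \in S)) (boolP (j \in S)) => iS [] jS //.
        by case: nsd; left; split; [apply/ei|move/ej; rewrite (negbTE jS)].
      by case: nsd; right; split; [apply/ej|move/ei; rewrite (negbTE iS)].
  by apply: (mulfI n0); rewrite mulrA divff // mul1r -e mulfK // pnatr_eq0.
(* For fixed [i] and [j] the distance is [1/2] at every [N] above both, hence also in the limit. *)
have [Q hQ Qle] := charge_ultralimit (FF := \oo) _ hs.
have := pack (charge_phi_measure phi setT hQ) 2^-1; rewrite invr_gt0 ltr0n.
move=> /(_ isT); rewrite packing_number_eqy ?ltxx // => l.
exists (fun i => y i); split=> // i j ij; rewrite gholds_triangle /=.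
suff /andP[] : 2^-1 <= Q (symd (inst (y i)) (inst (y j))) <= 2^-1 by [].
apply: Qle; exists l => // N /= lN.
rewrite (half N (widen_ord lN i) (widen_ord lN j)) ?lexx //.
by apply: contraTneq ij => /(congr1 val)/= ->; rewrite ltnn.
Qed.

End Packing.

Unset Implicit Arguments.
Set Strict Implicit.
Set Printing Implicit Defensive.

Theorem theorem5p23 (R : realType) (K : Type) (L : language)
    (T : set (sentence L)) (hT : complete_theory T)
    (U : structure L) (hU : monster_model K T U)
    (m n : nat) (phi : formula L (m + n)) :
  [<-> NIP U phi;
       forall M : set U, elementary_submodel T M -> small K M ->
         forall mu : phi_measure R phi M,
         exists nu : phi_measure R phi [set: U],
           agree_on phi M nu mu /\ smooth K nu;
       forall M : set U, elementary_submodel T M -> small K M ->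
         M #<= [set: all_formulas L] ->
         forall mu : phi_measure R phi M,
         exists nu : phi_measure R phi [set: U],
           agree_on phi M nu mu /\ strongly_definable K triangle nu;
       forall (mu : phi_measure R phi [set: U]) (eps : R), 0 < eps ->
         (packing_number mu eps < +oo)%E].
Proof.
have [UT hK satU _] := hU; tfae.
- by move=> nip M _ smM mu; exact: (NIP_smooth_extension hK satU).
- move=> smooth_ext M elM smM _ mu.
  have [nu [nu_mu nu_smooth]] := smooth_ext M elM smM mu.
  by exists nu; split=> //; exact: (smooth_strongly_definable hK satU).
- exact: strongly_definable_packing_lty UT hK.
- exact: packing_lty_NIP.
Qed.
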